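(* Let $p$ be a prime, let $G$ be a uniform pro-$p$ group, and let $H$ be a (not necessarily closed) virtually solvable subgroup of $G$. Then $H$ is a unique product group. In fact, $H$ has a series $1 = H_0 \lhd H_1 \lhd H_2 \lhd \dots \lhd H_n = H$ such that $H_i \lhd H$ and $H_{i+1}/H_i$ is torsion-free abelian for all $i$.
   Context: A group $H$ is a unique product group if for any two nonempty finite subsets $X,Y$ of $H$ there exists at least one element $g\in H$ which has a unique representation $g=xy$ with $x\in X$ and $y\in Y$. A pro-$p$ group $G$ is powerful if $G/\overline{G^p}$ is abelian (for $p$ odd), respectively $G/\overline{G^4}$ is abelian (for $p=2$), where $\overline{G^k}$ is the closure of the subgroup generated by $k$-th powers. A pro-$p$ group $G$ is uniform if it is topologically finitely generated, powerful, and $|P_i(G):P_{i+1}(G)| = |G:P_2(G)|$ for all $i \ge 1$, where $P_1(G)=G$ and $P_{i+1}(G)=\overline{P_i(G)^p[P_i(G),G]}$. (Equivalently: $G$ is topologically finitely generated, powerful and torsion free.) A group is virtually solvable if it has a solvable subgroup of finite index. *)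

(* Defs.v *)
From HB Require Import structures.
From mathcomp Require Import ssreflect ssrbool ssrfun eqtype ssrnat seq choice.
From mathcomp Require Import monoid prime.
From mathcomp Require Import boolp classical_sets functions cardinality topology.

Set Implicit Arguments.
Unset Strict Implicit.
Unset Printing Implicit Defensive.

Local Open Scope classical_set_scope.
Local Open Scope card_scope.
Local Open Scope group_scope.

HB.mixin Record isTopologicalGroup G & Topological G & Group G := {
  mulg_continuous : continuous (fun x : G * G => x.1 * x.2);
  invg_continuous : continuous (fun x : G => x^-1)
}.

#[short(type="topologicalGroupType")]
HB.structure Definition TopologicalGroup :=
  {G of Topological G & Group G & isTopologicalGroup G}.

(* Subgroups are classical sets, since they are compared with topological
   closures and need not be closed. *)
Definition subgroup (G : groupType) (K : set G) : Prop := group_closed [in K].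

Definition generated (G : groupType) (A : set G) : set G := smallest (@subgroup G) A.

Definition mulset (G : groupType) (A B : set G) : set G :=
  [set x * y | x in A & y in B].

Definition normal_in (G : groupType) (N K : set G) : Prop :=
  [/\ subgroup N, subgroup K, N `<=` K & {in N & K, forall x y, x ^ y \in N}].

(* The set of left cosets of [N] in [K].  When [N] is normal in [K] this is the
   underlying set of the quotient group [K / N], whose product is [mulset] and
   whose identity element is [N]. *)
Definition cosets (G : groupType) (K N : set G) : set (set G) :=
  [set mulset [set x] N | x in K].

Definition abelian_quotient (G : groupType) (K N : set G) : Prop :=
  {in cosets K N &, forall A B, mulset A B = mulset B A}.

(* [iter n (mulset A) N] is the power [A ^+ n] computed in [K / N]. *)
Definition torsion_free_quotient (G : groupType) (K N : set G) : Prop :=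
  {in cosets K N, forall A,
    forall n, (0 < n)%N -> iter n (mulset A) N = N -> A = N}.

Definition finite_index (G : groupType) (K N : set G) : Prop :=
  finite_set (cosets K N).

(* The subgroup generated by the [k]-th powers of elements of [K]. *)
Definition power_subgroup (G : groupType) (k : nat) (K : set G) : set G :=
  generated [set x ^+ k | x in K].

Definition commutator_subgroup (G : groupType) (K L : set G) : set G :=
  generated [set [~ x, y] | x in K & y in L].

Definition derived_series (G : groupType) (K : set G) (n : nat) : set G :=
  iter n (fun L => commutator_subgroup L L) K.

Definition solvable (G : groupType) (K : set G) : Prop :=
  exists n, derived_series K n = [set 1].

Definition virtually_solvable (G : groupType) (H : set G) : Prop :=
  exists K, [/\ subgroup K, K `<=` H, solvable K & finite_index H K].

Definition unique_product (G : groupType) (H : set G) : Prop :=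
  forall X Y : set G, finite_set X -> finite_set Y ->
    X `<=` H -> Y `<=` H -> X !=set0 -> Y !=set0 ->
    exists2 g, H g &
      exists! xy : G * G, [/\ X xy.1, Y xy.2 & g = xy.1 * xy.2].

Definition profinite (G : topologicalGroupType) : Prop :=
  [/\ compact [set: G], hausdorff_space G &
      forall U, nbhs (1 : G) U -> exists K, [/\ subgroup K, open K & K `<=` U]].

Definition pro_p (p : nat) (G : topologicalGroupType) : Prop :=
  profinite G /\
  forall N : set G, open N -> normal_in N [set: G] ->
    exists k, cosets [set: G] N #= `I_(p ^ k)%N.

Definition topologically_fg (G : topologicalGroupType) : Prop :=
  exists2 X : set G, finite_set X & closure (generated X) = [set: G].

Definition powerful (p : nat) (G : topologicalGroupType) : Prop :=
  abelian_quotient [set: G]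
    (closure (power_subgroup (if p == 2 then 4 else p) [set: G])).

(* The lower [p]-series, numbered from 1: [lower_p_series p G 1] is [G]. *)
Definition lower_p_series (p : nat) (G : topologicalGroupType) (i : nat) : set G :=
  iter i.-1
    (fun K => closure (mulset (power_subgroup p K)
                              (commutator_subgroup K [set: G])))
    [set: G].
Arguments lower_p_series : clear implicits.

Definition uniform_pro_p (p : nat) (G : topologicalGroupType) : Prop :=
  [/\ pro_p p G, topologically_fg G, powerful p G &
      forall i, (0 < i)%N ->
        cosets (lower_p_series p G i) (lower_p_series p G i.+1)
          #= cosets [set: G] (lower_p_series p G 2)].

(* Main.v *)
Require Import Defs.
From HB Require Import structures.
From mathcomp Require Import ssreflect ssrbool ssrfun eqtype ssrnat seq choice ssrAC.
From mathcomp Require Import fintype generic_quotient monoid prime div binomial finmap bigop.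
From mathcomp Require finset fingroup automorphism perm commutator.
From mathcomp Require pgroup nilpotent sylow maximal abelian.
From mathcomp Require Import ssralg ssrint zmodp poly matrix mxpoly.

(* The idea is to linearise [G] and to imitate the Lie-Kolchin theorem.

   Write [G_n] for the [n+1]-st term of the lower p-series.  In a uniform group
   [G_n] is the set of [p^n]-th powers, and [x + y], the element [z] such that
   [z^(p^n)] is congruent to [x^(p^n) y^(p^n)] modulo [G_(2n)] for all [n], makes
   [G] an abelian group [L] with [p^n L = G_n].  It is torsion-free, p-adically
   separated and finite modulo [p]; [G] acts on it by conjugation, trivially modulo
   [p] (modulo [4] if [p = 2]), and only central elements act trivially.

   A congruence like this one makes roots unique: if [a^m] and [b^m] agree on a
   quotient of invariant pure closed subgroups of [L], so do [a] and [b].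
   Let [W/U] be such a quotient which is irreducible for the virtually solvable
   group [H].  Climbing up the derived series of a normal solvable subgroup of
   finite index, one finds that it is central on [W/U]: the conjugates of [c] under
   the powers of [g], if they commute, have finitely many eigenvalues, so two of
   them differ by a nilpotent operator, which must vanish on [W/U], and then [c]
   commutes with a power of [g], hence with [g].  By uniqueness of roots again, all
   of [H] is commutative on [W/U].

   So [L] has an [H]-invariant flag on whose factors [H] is commutative.  Let [D_k] be
   the subgroup of the elements [h] of [H] such that [h - 1] lowers the flag by [k] steps.
   Then [H = D_0 > D_1 > ... > D_n > 1] is the required series; [D_n] is central.
   Unique products come from a left order on [H], assembled from orders on the
   torsion-free abelian factors. *)

Set Implicit Arguments.
Unset Strict Implicit.
Unset Printing Implicit Defensive.

(** * A descent step in finite p-groups *)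

Section FiniteGroups.
Import finset fingroup automorphism commutator.
Import pgroup nilpotent sylow maximal abelian.
Local Open Scope group_scope.

(** Take for [M'] the group Phi(M)[M, Q]. As [Q] is nilpotent, [M, Q] is proper in [M], and
    adjoining the Frattini subgroup, which consists of non-generators, cannot fill [M]. This is one
    step of the lower p-series in a finite image of [G]. *)
Lemma p_group_lower_step (gT : finGroupType) (Q M : {group gT}) (p : nat) :
    prime p -> p.-group Q -> M <| Q -> M :!=: 1 ->
  exists M' : {group gT}, [/\ M' \proper M, M' <| Q,
    forall x, x \in M -> x ^+ p \in M' &
    forall x y, x \in M -> y \in Q -> [~ x, y] \in M'].
Proof.
move=> p_pr pQ nMQ M1; have [sMQ nQM] := andP nMQ.
have pM := pgroupS sMQ pQ.
exists ('Phi(M) <*> [~: M, Q])%G; split.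
- rewrite properEneq join_subG Phi_sub commg_subl nQM /= andbT.
  apply/eqP => /Phi_nongen; rewrite genGid /= => e.
  have /(nil_comm_properl (pgroup_nil pQ) sMQ M1) : Q \subset 'N_Q(M) by rewrite subsetI subxx.
  by rewrite e properxx.
- apply: normalY; first exact: char_normal_trans (Phi_char M) nMQ.
  by rewrite /normal commg_normr (subset_trans _ sMQ) // commg_subl.
- move=> x Mx; apply: (subsetP (joing_subl _ _)).
  rewrite (Phi_joing pM); apply: (subsetP (joing_subr _ _)).
  by rewrite -(expn1 p); apply: Mho_p_elt => //; exact: mem_p_elt pM Mx.
- by move=> x y Mx Qy; apply: (subsetP (joing_subr _ _)); apply: mem_commg.
Qed.

End FiniteGroups.

From mathcomp Require Import boolp classical_sets functions cardinality topology.

(** * Subgroups and quotients *)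

Section AbstractGroups.
Local Open Scope classical_set_scope.
Local Open Scope group_scope.
Local Open Scope quotient_scope.

Definition normal_subgroup (G : groupType) (N : set G) : Prop :=
  subgroup N /\ forall x y, N x -> N (x ^ y).

Section Subgroups.
Variable G : groupType.
Implicit Types (K N : set G) (x y : G).

Lemma subgroupP K :
  subgroup K <-> K 1 /\ forall x y, K x -> K y -> K (x / y).
Proof.
split=> [[K1 Kd]|[K1 Kd]].
  by split=> [|x y Kx Ky]; [rewrite -in_setE | rewrite -in_setE; apply: Kd; rewrite inE].
by split=> [|x y]; rewrite !inE //; apply: Kd.
Qed.

Lemma subgroup1 K : subgroup K -> K 1.
Proof. by case/subgroupP. Qed.

Lemma subgroupF K x y : subgroup K -> K x -> K y -> K (x / y).
Proof. by case/subgroupP=> _; apply. Qed.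

Lemma subgroupV K x : subgroup K -> K x -> K x^-1.
Proof. by move=> sK Kx; rewrite -[_^-1]mul1g; apply: subgroupF => //; exact: subgroup1. Qed.

Lemma subgroupM K x y : subgroup K -> K x -> K y -> K (x * y).
Proof. by move=> sK Kx Ky; rewrite -[y]invgK; apply: subgroupF => //; apply: subgroupV. Qed.

Lemma subgroupX K x n : subgroup K -> K x -> K (x ^+ n).
Proof.
move=> sK Kx; elim: n => [|n IHn]; first exact: subgroup1.
by rewrite expgS; apply: subgroupM.
Qed.

Lemma subgroupT : subgroup [set: G].
Proof. by apply/subgroupP; split. Qed.

Lemma subgroup_set1 : subgroup [set (1 : G)].
Proof. by apply/subgroupP; split=> //= x y -> ->; rewrite mulgV. Qed.

Lemma generated_subgroup (A : set G) : subgroup (generated A).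
Proof.
apply/subgroupP; split=> [B [/subgroupP[B1 _] _] //|x y Ax Ay B [sB AB]].
by apply: subgroupF => //; [apply: Ax | apply: Ay].
Qed.

Lemma sub_generated (A : set G) : A `<=` generated A.
Proof. exact: sub_smallest. Qed.

Lemma generated_min (A K : set G) : subgroup K -> A `<=` K -> generated A `<=` K.
Proof. by move=> sK AK; apply: smallest_sub. Qed.

Lemma mulsetP (A B : set G) x :
  mulset A B x <-> exists a b, [/\ A a, B b & x = a * b].
Proof.
split=> [[a Aa [b Bb <-]]|[a [b [Aa Bb ->]]]]; first by exists a, b.
by exists a => //; exists b.
Qed.

Lemma normal_subgroupT : normal_subgroup [set: G].
Proof. by split=> //; exact: subgroupT. Qed.

Lemma normal_inP N K : normal_in N K <->
  [/\ subgroup N, subgroup K, N `<=` K & forall x y, N x -> K y -> N (x ^ y)].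
Proof.
by split=> -[sN sK NK nN]; split=> // x y; have := nN x y; rewrite ?inE //;
  move=> H *; apply: H.
Qed.

Lemma normal_subgroup_in N : normal_subgroup N -> normal_in N [set: G].
Proof.
move=> [sN nN]; apply/normal_inP; split=> //; first exact: subgroupT.
by move=> x y Nx _; apply: nN.
Qed.

Lemma normal_subgroupR N x y : normal_subgroup N -> N x -> N [~ x, y].
Proof.
by case=> sN nN Nx; rewrite commgEl; apply: subgroupM => //; [apply: subgroupV|apply: nN].
Qed.

Lemma in_coset K x y : subgroup K -> K (x^-1 * y) -> K x -> K y.
Proof. by move=> sK Kxy Kx; rewrite -(mulVKg x y); apply: subgroupM. Qed.

Lemma mulset1P N (a z : G) : mulset [set a] N z <-> N (a^-1 * z).
Proof.
split=> [/mulsetP[_ [n [-> Nn ->]]]|Nz]; first by rewrite mulKg.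
by apply/mulsetP; exists a, (a^-1 * z); rewrite mulVKg.
Qed.

Lemma mulset1_eq N (a b : G) : subgroup N ->
  mulset [set a] N = mulset [set b] N <-> N (a^-1 * b).
Proof.
move=> sN; split=> [e|Nab].
  by apply/mulset1P; rewrite e; apply/mulset1P; rewrite mulVg; exact: subgroup1.
apply/seteqP; split=> z /mulset1P Nz; apply/mulset1P.
  by rewrite -[b^-1](mulgK a) -mulgA; apply: (subgroupM sN) => //;
    rewrite -[b^-1 * a]invgK invgM invgK; apply: subgroupV.
by rewrite -[a^-1](mulgK b) -mulgA; apply: (subgroupM sN).
Qed.

End Subgroups.

Section Quotient.
Variables (G : groupType) (N : set G) (nN : normal_subgroup N).

Let eqN : rel G := fun x y => `[< N (x^-1 * y) >].

Lemma eqN_equiv : equiv_class_of eqN.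
Proof.
have [sN _] := nN.
have eqNV x y : eqN x y -> eqN y x.
  move=> /asboolP Nxy; apply/asboolP.
  by rewrite -[y^-1 * x]invgK invgM invgK; apply: subgroupV.
split=> [x|x y|y x z].
- by apply/asboolP; rewrite mulVg; apply: subgroup1.
- by apply/idP/idP; exact: eqNV.
- move=> /asboolP Nxy /asboolP Nyz; apply/asboolP.
  by rewrite -[x^-1](mulgK y) -mulgA; apply: subgroupM => //; rewrite ?mulgA.
Qed.

Let eqNr : equiv_rel G := EquivRelPack eqN_equiv.

Let quo := {eq_quot eqNr}.

Let quo_pi (x : G) : quo := \pi_quo x.

Let quo_piE x y : (quo_pi x = quo_pi y) <-> N (x^-1 * y).
Proof.
split=> [/eqP|Nxy]; first by rewrite eqmodE => /asboolP.
by apply/eqP; rewrite eqmodE; apply/asboolP.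
Qed.

Let qmul (a b : quo) : quo := quo_pi (repr a * repr b).
Let qinv (a : quo) : quo := quo_pi (repr a)^-1.

Let qrepr x : N (x^-1 * repr (quo_pi x)).
Proof. by apply/quo_piE; rewrite /quo_pi reprK. Qed.

Let qmulE x y : qmul (quo_pi x) (quo_pi y) = quo_pi (x * y).
Proof.
have [sN cN] := nN.
apply/esym/quo_piE; rewrite invgM -mulgA; set a := repr _; set b := repr _.
have Na : N (x^-1 * a) := qrepr x.
have Nb : N (y^-1 * b) := qrepr y.
have -> : y^-1 * (x^-1 * (a * b)) = (x^-1 * a) ^ y * (y^-1 * b).
  by rewrite conjgE !mulgA mulgK.
by apply: subgroupM => //; apply: cN.
Qed.

Let qinvE x : qinv (quo_pi x) = quo_pi x^-1.
Proof.
have [sN cN] := nN.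
apply/quo_piE; rewrite invgK; set a := repr _.
have Na : N (x^-1 * a) := qrepr x.
have -> : a * x^-1 = (x^-1 * a) ^ x^-1 by rewrite conjgE invgK !mulgA mulgV mul1g.
exact: cN.
Qed.

Let quo_ex (a : quo) : exists x, a = quo_pi x.
Proof. by exists (repr a); rewrite /quo_pi reprK. Qed.

Let qmulA : associative qmul.
Proof.
move=> a b c; have [x ->] := quo_ex a; have [y ->] := quo_ex b.
by have [z ->] := quo_ex c; rewrite !qmulE mulgA.
Qed.
Let qmul1 : left_id (quo_pi 1) qmul.
Proof. by move=> a; have [x ->] := quo_ex a; rewrite qmulE mul1g. Qed.
Let qmulr1 : right_id (quo_pi 1) qmul.
Proof. by move=> a; have [x ->] := quo_ex a; rewrite qmulE mulg1. Qed.
Let qmulV : left_inverse (quo_pi 1) qinv qmul.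
Proof. by move=> a; have [x ->] := quo_ex a; rewrite qinvE qmulE mulVg. Qed.
Let qmulrV : right_inverse (quo_pi 1) qinv qmul.
Proof. by move=> a; have [x ->] := quo_ex a; rewrite qinvE qmulE mulgV. Qed.

(** Congruences modulo [N] become equations in [Q]; most later computations with powers and
    commutators go through such an [f]. *)
Lemma quotient_group : exists (Q : groupType) (f : UMagmaMorphism.type G Q),
  forall x, f x = 1 <-> N x.
Proof.
pose gQ := isGroup.Build {eq_quot eqNr} qmulA qmul1 qmulr1 qmulV qmulrV.
pose Q : groupType := HB.pack {eq_quot eqNr} gQ.
have f1 : quo_pi 1 = 1 :> Q by [].
have fM : {morph (quo_pi : G -> Q) : x y / x * y} by move=> x y; rewrite -[LHS]qmulE.
pose mf := isUMagmaMorphism.Build G Q quo_pi (conj f1 fM).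
pose f : UMagmaMorphism.type G Q := HB.pack (quo_pi : G -> Q) mf.
exists Q, f => x; have -> : f x = quo_pi x by [].
rewrite -f1; split=> [e|Nx].
  by have /quo_piE := esym e; rewrite invg1 mul1g.
by apply/esym/quo_piE; rewrite invg1 mul1g.
Qed.

End Quotient.


(** * Powers of a product with central commutator *)

Section CentralPowers.
Variables (Q : groupType) (x c : Q).
Let z := [~ c, x].
Hypotheses (xz : commute x z) (cz : commute c z).

(** Moving [c ^+ m] past one more factor [x] costs [z ^+ m], and the costs 0 + 1 + ... + (m - 1) add
    up to the binomial coefficient. *)
Lemma expgM_commute_commutator m : (x * c) ^+ m = x ^+ m * c ^+ m * z ^+ 'C(m, 2).
Proof.
have cxm n : c ^+ n * x = x * c ^+ n * z ^+ n.
  elim: n => [|n IHn]; first by rewrite !expg0 !mulg1 mul1g.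
  have zcn : z * c ^+ n = c ^+ n * z by apply: commuteX; apply: commute_sym.
  by rewrite expgS -mulgA IHn !mulgA (commgC c x) -/z -(mulgA _ z) zcn expgS !mulgA.
elim: m => [|m IHm]; first by rewrite !expg0 !mulg1.
rewrite expgSr IHm binS bin1 addnC expgnDr.
have zC : commute (z ^+ 'C(m, 2)) (x * c).
  by apply: commuteM; apply: commute_sym; apply: commuteX.
rewrite -mulgA zC !mulgA; congr (_ * _).
rewrite -(mulgA (x ^+ m)) cxm expgSr !mulgA -!mulgA; congr (_ * (_ * _)).
by rewrite expgSr -mulgA (commuteX m cz).
Qed.
End CentralPowers.

End AbstractGroups.

(** * The lower p-series *)

Section PAdicSeries.
Local Open Scope classical_set_scope.
Local Open Scope group_scope.

(** * Continuity and closures in topological groups *)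

Section TopologicalGroups.
Variable G : topologicalGroupType.

Lemma continuousM (T : topologicalType) (f g : T -> G) :
  continuous f -> continuous g -> continuous (fun x => f x * g x).
Proof.
move=> cf cg x.
apply: (@continuous_comp _ _ _ (fun x => (f x, g x)) (fun z : G * G => z.1 * z.2)).
  exact: cvg_pair (cf x) (cg x).
exact: mulg_continuous.
Qed.

Lemma continuousV (T : topologicalType) (f : T -> G) :
  continuous f -> continuous (fun x => (f x)^-1).
Proof.
move=> cf x; apply: (@continuous_comp _ _ _ f (fun x => x^-1)); first exact: cf.
exact: invg_continuous.
Qed.

Lemma continuousX (T : topologicalType) (f : T -> G) n :
  continuous f -> continuous (fun x => f x ^+ n).
Proof.
move=> cf; elim: n => [|n IHn]; first by move=> x; exact: cvg_cst.
by rewrite (_ : (fun x => _) = (fun x => f x * f x ^+ n));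
  [exact: continuousM|apply/funext => x; rewrite expgS].
Qed.

Lemma continuousJ (T : topologicalType) (f g : T -> G) :
  continuous f -> continuous g -> continuous (fun x => f x ^ g x).
Proof.
by move=> cf cg; apply: continuousM; [exact: continuousV|exact: continuousM].
Qed.

Lemma continuousR (T : topologicalType) (f g : T -> G) :
  continuous f -> continuous g -> continuous (fun x => [~ f x, g x]).
Proof. by move=> cf cg; apply: continuousM; [exact: continuousV|exact: continuousJ]. Qed.

Lemma continuous_id (T : topologicalType) : continuous (fun x : T => x).
Proof. by move=> x; exact: cvg_id. Qed.

Lemma continuous_cst (T : topologicalType) (a : G) : continuous (fun _ : T => a).
Proof. by move=> x; exact: cvg_cst. Qed.

Lemma closed_preimage (f : G -> G) (A : set G) :
  continuous f -> closed A -> closed [set x | A (f x)].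
Proof. by move=> /continuous_closedP; apply. Qed.

Lemma closure_min (A C : set G) : closed C -> A `<=` C -> closure A `<=` C.
Proof. by move=> cC AC; rewrite closureE; apply: smallest_sub. Qed.

(** Division is continuous in each variable, so the two variables can be moved from [K] to its
    closure one after the other. *)
Lemma subgroup_closure (K : set G) : subgroup K -> subgroup (closure K).
Proof.
move=> sK; apply/subgroupP; split; first by apply: subset_closure; exact: subgroup1.
have cF x : closed [set y | closure K (x / y)].
  apply: (closed_preimage _ (@closed_closure _ K)).
  by apply: continuousM; [exact: continuous_cst | apply/continuousV/continuous_id].
have cF' y : closed [set x | closure K (x / y)].
  apply: (closed_preimage _ (@closed_closure _ K)).
  by apply: continuousM; [exact: continuous_id | exact: continuous_cst].
move=> x y + Ky; apply: (@closure_min _ [set x | closure K (x / y)]); first exact: cF'.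
move=> {}x Kx; move: Ky.
apply: (@closure_min _ [set y | closure K (x / y)]); first exact: cF.
by move=> {}y Ky /=; apply: subset_closure; exact: subgroupF.
Qed.

Lemma normal_subgroup_closure (K : set G) :
  normal_subgroup K -> normal_subgroup (closure K).
Proof.
move=> [sK nK]; split; first exact: subgroup_closure.
move=> x y; apply: (@closure_min K [set x | closure K (x ^ y)]).
  apply: (closed_preimage _ (@closed_closure _ K)).
  by apply: continuousJ; [exact: continuous_id | exact: continuous_cst].
by move=> z Kz /=; apply: subset_closure; apply: nK.
Qed.

End TopologicalGroups.

Lemma generated_normal (G : groupType) (A : set G) :
  (forall x y, A x -> A (x ^ y)) -> normal_subgroup (generated A).
Proof.
move=> nA; split; first exact: generated_subgroup.
move=> x y; apply: (@generated_min _ _ [set x | generated A (x ^ y)]).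
  apply/subgroupP; split=> /= [|a b Aa Ab].
    by rewrite conj1g; apply: subgroup1; apply: generated_subgroup.
  by rewrite conjMg conjVg; apply: (subgroupF (@generated_subgroup _ A)).
by move=> a Aa; apply: sub_generated; apply: nA.
Qed.

Lemma mulset_normal (G : groupType) (A B : set G) :
  normal_subgroup A -> normal_subgroup B -> normal_subgroup (mulset A B).
Proof.
move=> [sA nA] [sB nB]; split; last first.
  move=> x y /mulsetP[a [b [Aa Bb ->]]]; apply/mulsetP; exists (a ^ y), (b ^ y).
  by split; [exact: nA|exact: nB|rewrite conjMg].
apply/subgroupP; split; first by apply/mulsetP; exists 1, 1; rewrite mulg1; split=> //; exact: subgroup1.
move=> _ _ /mulsetP[a [b [Aa Bb ->]]] /mulsetP[c [d [Ac Bd ->]]].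
apply/mulsetP; exists (a * c^-1), ((b * d^-1) ^ c^-1); split.
- exact: subgroupF.
- by apply: nB; apply: subgroupF.
- by rewrite conjgE invgK invgM !mulgA mulgVK.
Qed.

(** * Basic properties of the lower p-series *)

Section LowerSeries.
Variables (p : nat) (G : topologicalGroupType).
Local Notation P := (lower_p_series p G).

Lemma lower_p_seriesS i : (0 < i)%N ->
  P i.+1 = closure (mulset (power_subgroup p (P i)) (commutator_subgroup (P i) [set: G])).
Proof. by case: i. Qed.

Lemma lower_p_series_normal i : normal_subgroup (P i).
Proof.
case: i => [|i]; first exact: normal_subgroupT.
elim: i => [|i IHi]; first exact: normal_subgroupT.
rewrite lower_p_seriesS //; apply: normal_subgroup_closure; apply: mulset_normal; apply: generated_normal.
  by move=> x y [a Pa <-]; exists (a ^ y); [apply: IHi.2|rewrite conjXg].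
move=> x y [a Pa [b _ <-]]; exists (a ^ y); first exact: IHi.2.
by exists (b ^ y) => //; rewrite conjRg.
Qed.

Lemma lower_p_series_closed i : closed (P i).
Proof.
case: i => [|[|i]]; [exact: closedT|exact: closedT|].
by rewrite lower_p_seriesS //; exact: closed_closure.
Qed.

Lemma lower_p_seriesX i x : (0 < i)%N -> P i x -> P i.+1 (x ^+ p).
Proof.
move=> i0 Px; rewrite lower_p_seriesS //; apply: subset_closure; apply/mulsetP.
exists (x ^+ p), 1; rewrite mulg1; split=> //.
  by apply: sub_generated; exists x.
by apply: subgroup1; apply: generated_subgroup.
Qed.

Lemma lower_p_seriesR i x g : (0 < i)%N -> P i x -> P i.+1 [~ x, g].
Proof.
move=> i0 Px; rewrite lower_p_seriesS //; apply: subset_closure; apply/mulsetP.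
exists 1, [~ x, g]; rewrite mul1g; split=> //.
  by apply: subgroup1; apply: generated_subgroup.
by apply: sub_generated; exists x => //; exists g.
Qed.

(** The induction principle of the series: inclusion in a closed subgroup is tested on [p]-th powers
    and commutators only. *)
Lemma lower_p_series_min i (C : set G) : (0 < i)%N -> subgroup C -> closed C ->
    (forall x, P i x -> C (x ^+ p)) -> (forall x g, P i x -> C [~ x, g]) ->
  P i.+1 `<=` C.
Proof.
move=> i0 sC cC CX CR; rewrite lower_p_seriesS //; apply: closure_min => //.
move=> _ /mulsetP[a [b [Pa Pb ->]]]; apply: subgroupM => //.
  by move: Pa; apply: generated_min => // _ [x Px <-]; exact: CX.
by move: Pb; apply: generated_min => // _ [x Px [g _ <-]]; exact: CR.
Qed.

Lemma lower_p_series_le i j : (i <= j)%N -> P j `<=` P i.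
Proof.
move=> /subnK <-; elim: (j - i)%N => [//|k IHk].
apply: subset_trans IHk; rewrite addSn; case: (k + i)%N => [//|{j k}i'].
have nP := lower_p_series_normal i'.+1.
apply: lower_p_series_min => //; first by case: nP.
- exact: lower_p_series_closed.
- by move=> x Px; apply: subgroupX => //; case: nP.
- by move=> x g Px; apply: normal_subgroupR.
Qed.

End LowerSeries.

Lemma conjg_commg (G : groupType) (x y : G) : x ^ y = x * [~ x, y].
Proof. by rewrite commgEl mulVKg. Qed.

Section LowerSeriesCommutators.
Variables (p : nat) (G : topologicalGroupType).
Local Notation P := (lower_p_series p G).

(** With the closedness shown next, this makes [lower_p_series_min] applicable to the second
    argument of a commutator. *)
Lemma centralizer_mod_subgroup (K N : set G) :
  normal_subgroup N -> subgroup [set y | forall x, K x -> N [~ x, y]].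
Proof.
move=> [sN nN]; apply/subgroupP; split=> /= [x _|y z Ny Nz x Kx].
  by rewrite commg1; exact: subgroup1.
have -> : [~ x, y / z] = ([~ x, z]^-1 * [~ x, y]) ^ z^-1.
  by rewrite invgR !commgEl !conjgE; rewrite !gnorm.
by apply: nN; apply: subgroupM; [|apply: subgroupV => //; apply: Nz|apply: Ny].
Qed.

Lemma centralizer_mod_closed (K N : set G) :
  closed N -> closed [set y | forall x, K x -> N [~ x, y]].
Proof.
move=> cN y Cy x Kx; move: Cy.
apply: (@closure_min _ _ [set y | N [~ x, y]]); last by move=> z /= /(_ x Kx).
by apply: closed_preimage => //; apply: continuousR; [exact: continuous_cst|exact: continuous_id].
Qed.

Lemma lower_p_seriesRR i j x y : (0 < i)%N -> (0 < j)%N ->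
  P i x -> P j y -> P (i + j) [~ x, y].
Proof.
move=> i0; case: j => // j _; elim: j i i0 x y => [|j IHj] i i0 x y Px Py.
  by rewrite addn1; apply: lower_p_seriesR.
move: y Py x Px; have nN := lower_p_series_normal p G (i + j.+2).
have cN := @lower_p_series_closed p G (i + j.+2).
apply: (lower_p_series_min _ (centralizer_mod_subgroup _ nN) (centralizer_mod_closed cN)) => //.
(* Modulo [P (i + j.+2)] the commutator of [x] and [y] is fixed by [y], so the commutator of [x] and
   [y ^+ p] is its [p]-th power. *)
- move=> y Py x Px; have [Q [f fN]] := quotient_group nN.
  apply/fN; rewrite gmulfR gmulfXn commgEl.
  set a := f x; set b := f y.
  have Pz : P (i + j.+1) [~ x, y] by exact: IHj.
  have zb : [~ a, b] ^ b = [~ a, b].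
    apply/conjg_fixP/eqP; rewrite -!gmulfR; apply/fN; rewrite addnS; apply: lower_p_seriesR => //.
    by rewrite addnS.
  have -> n : a ^ (b ^+ n) = a * [~ a, b] ^+ n.
    elim: n => [|n IHn]; first by rewrite !expg0 conjg1 mulg1.
    by rewrite expgSr conjgM IHn conjMg conjXg zb expgS mulgA -conjg_commg.
  rewrite mulKg -gmulfR -gmulfXn; apply/fN; rewrite addnS; apply: lower_p_seriesX => //.
  by rewrite addnS.
(* A form of the three subgroups lemma: modulo [P (i + j.+2)], [y ^ g] and [y] conjugate the
   elements of [P i] in the same way, so [[~ y, g]] centralises them. *)
- move=> y g Py x0 Px0; have [Q [f fN]] := quotient_group nN.
  have key x : P i x -> f x ^ (f y ^ f g) = f x ^ f y.
    move=> Px; set a := f x; set b := f y; set h := f g.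
    have Pz : P (i + j.+1) [~ x, y] by exact: IHj.
    have zC u : commute [~ a, b] (f u).
      apply/commgP/eqP; rewrite -!gmulfR; apply/fN; rewrite addnS.
      by apply: lower_p_seriesR => //; rewrite addnS.
    have wb : [~ a, h^-1] ^ b = [~ a, h^-1].
      apply/conjg_fixP/eqP; rewrite -!gmulfV -!gmulfR; apply/fN; rewrite addnS -addSn.
      by apply: IHj => //; apply: lower_p_seriesR.
    have -> : a ^ (b ^ h) = ((a ^ h^-1) ^ b) ^ h.
      by rewrite -!conjgM; congr (_ ^ _); rewrite conjgE !mulgA.
    rewrite (conjg_commg a h^-1) conjMg wb (conjg_commg a b).
    rewrite -mulgA.
    have -> : a * ([~ a, b] * [~ a, h^-1]) = [~ a, b] * (a * [~ a, h^-1]).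
      by rewrite mulgA -(zC x) -mulgA.
    rewrite -(conjg_commg a h^-1) conjMg -(conjgM a) mulVg conjg1.
    have -> : [~ a, b] ^ h = [~ a, b] by rewrite conjgE zC mulKg.
    exact: zC.
  apply/fN; rewrite !gmulfR; apply/eqP/conjg_fixP.
  rewrite commgEl conjgM -gmulfV -gmulfJ key; last first.
    by case: (lower_p_series_normal p G i) => _; apply.
  by rewrite -gmulfJ conjgKV.
Qed.

End LowerSeriesCommutators.

End PAdicSeries.

(** * Uniform groups *)

Section UniformGroups.
Local Open Scope classical_set_scope.
Local Open Scope group_scope.

Lemma eq_card_image_inj (T : choiceType) (A : set T) (f : T -> T) :
  finite_set A -> (f @` A #= A)%card -> {in A &, injective f}.
Proof.
move=> fA /(fcard_eq (finite_image f fA) fA); rewrite fset_set_image // => /eqP/card_in_imfsetP inj x y.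
by move=> Ax Ay; apply: inj; rewrite in_fset_set.
Qed.

(** * The power map in powerful groups *)

Section PowerfulGroups.
Variables (p : nat) (G : topologicalGroupType).
Local Notation P := (lower_p_series p G).
Let r := if p == 2 then 4 else p.
Let Z := closure (power_subgroup r [set: G]).
Hypotheses (p_prime : prime p) (G_powerful : powerful p G).

Lemma powerful_commutator x y : Z [~ x, y].
Proof.
have nZ : normal_subgroup Z.
  apply: normal_subgroup_closure; apply: generated_normal => _ b [a _ <-].
  by exists (a ^ b) => //; rewrite conjXg.
have [sZ cZ] := nZ.
have inZ u : mulset [set u] Z \in cosets [set: G] Z by rewrite inE; exists u.
have /seteqP[+ _] := G_powerful (inZ y) (inZ x).
have Zu u : mulset [set u] Z u by apply/mulsetP; exists u, 1; rewrite mulg1; split=> //; exact: subgroup1.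
have yx : mulset (mulset [set y] Z) (mulset [set x] Z) (y * x).
  by apply/mulsetP; exists y, x; split=> //; apply: Zu.
move=> /(_ _ yx)/mulsetP[_ [_ [/mulsetP[_ [a [-> Za ->]]] /mulsetP[_ [b [-> Zb ->]]] e]]].
have -> : [~ x, y] = (a ^ y * b)^-1.
  have -> : [~ x, y] = (y * x)^-1 * (x * y) by rewrite commgEl conjgE !gnorm.
  by rewrite e conjgE !gnorm.
by apply: (subgroupV sZ); apply: (subgroupM sZ) => //; apply: cZ.
Qed.

Lemma powerful_min (C : set G) : subgroup C -> closed C ->
  (forall x, C (x ^+ r)) -> forall x y, C [~ x, y].
Proof.
move=> sC cC Cr x y; move: (@powerful_commutator x y).
apply: closure_min => //; apply: generated_min => // _ [a _ <-]; exact: Cr.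
Qed.


(** For [p] = 2 a commutator gains two terms instead of one. At the start this is powerfulness,
    fourth powers being in [P 3]; it then passes to squares and commutators. *)
Lemma lower_2_seriesR j x g : p = 2%N -> (0 < j)%N -> P j x -> P j.+2 [~ x, g].
Proof.
move=> p2; case: j => // j _; elim: j x g => [|j IHj] x g Px.
  have [sP3 _] := lower_p_series_normal p G 3.
  apply: powerful_min => // [|y]; first exact: lower_p_series_closed.
  have -> : y ^+ r = (y ^+ p) ^+ p by rewrite /r p2 -expgnA.
  by do 2!apply: lower_p_seriesX => //.
have nN := lower_p_series_normal p G j.+4; have [sN _] := nN.
have cN := @lower_p_series_closed p G j.+4.
rewrite -invgR; apply: (subgroupV sN); move: x Px g.
suff: P j.+2 `<=` [set x | forall g, [set: G] g -> P j.+4 [~ g, x]].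
  by move=> H x /H /= {}H g; apply: H.
apply: lower_p_series_min => //.
- exact: centralizer_mod_subgroup.
- exact: centralizer_mod_closed.
- move=> x Px g _; rewrite -invgR; apply: (subgroupV sN).
  have Pc : P j.+3 [~ x, g] by exact: IHj.
  have -> : [~ x ^+ p, g] = [~ x, g] ^+ p * [~ [~ x, g], x] ^ [~ x, g].
    by rewrite p2 !expg2 !commgEl !conjgE; rewrite !gnorm.
  apply: (subgroupM sN); first by apply: lower_p_seriesX.
  by have [_ nP] := nN; apply: nP; apply: lower_p_seriesR.
- move=> x h Px g _; rewrite -invgR; apply: (subgroupV sN).
  by apply: lower_p_seriesR => //; exact: IHj.
Qed.

(** Modulo [P j.+2] the commutator of [c] and [x] is central, and the error is its power with
    exponent ['C(p, 2)]. For odd [p] this exponent is divisible by [p]; for [p] = 2 it is 1, but the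
    commutator already lies in [P j.+2]. *)
Lemma expgM_lower_p_series j x c : (0 < j)%N -> P j c ->
  P j.+2 ((x ^+ p * c ^+ p)^-1 * (x * c) ^+ p).
Proof.
move=> j0 Pc; have nN := lower_p_series_normal p G j.+2; have [Q [f fN]] := quotient_group nN.
have zC u : commute [~ f c, f x] (f u).
  apply/commgP/eqP; rewrite -!gmulfR; apply/fN.
  by do 2!apply: lower_p_seriesR => //.
apply/fN; rewrite gmulfM gmulfV !(gmulfXn, gmulfM).
rewrite expgM_commute_commutator; [|exact/commute_sym/zC..].
rewrite mulgA mulVg mul1g -gmulfR -gmulfXn; apply/fN.
have [sN _] := nN.
have [p2|p2] := eqVneq p 2%N.
  by rewrite p2 binn expg1 -p2; apply: lower_2_seriesR.
have /dvdnP[k ->] : (p %| 'C(p, 2))%N.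
  by apply: prime_dvd_bin => //=; rewrite ltn_neqAle eq_sym p2 prime_gt1.
rewrite mulnC expgnA; apply: (subgroupX _ sN); apply: lower_p_seriesX => //.
exact: lower_p_seriesR.
Qed.

Hypothesis G_compact : compact [set: G].
Hypothesis G_hausdorff : hausdorff_space G.

(** The products of a [p]-th power from [P i] and an element of [P i.+2] form a closed subgroup: the
    power map is multiplicative modulo [P i.+2], and the set is a continuous image of a compact one.
    So it suffices to test the generators of [P i.+1]. *)
Lemma lower_p_series_root_mod i y : (0 < i)%N -> P i.+1 y ->
  exists2 x, P i x & P i.+2 ((x ^+ p)^-1 * y).
Proof.
case: i => // i _.
pose C i := [set y | exists2 x, P i.+1 x & P i.+3 ((x ^+ p)^-1 * y)].
have sC k : subgroup (C k).
  have [sP _] := lower_p_series_normal p G k.+1.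
  have nN := lower_p_series_normal p G k.+3; have [sN _] := nN.
  apply/subgroupP; split=> [|a b [u Pu Na] [v Pv Nb]].
    by exists 1; rewrite ?expg1n ?invg1 ?mulg1; exact: subgroup1.
  exists (u / v); first exact: subgroupF.
  have := @expgM_lower_p_series k.+1 u v^-1 isT (subgroupV sP Pv).
  have [Q [f fN]] := quotient_group nN; move/fN; rewrite gmulfM gmulfV => /mulg1_eq.
  rewrite invgK => e; apply/fN.
  rewrite gmulfM gmulfV -e !(gmulfM, gmulfV, gmulfXn) expVgn.
  move/fN: Na; rewrite gmulfM gmulfV gmulfXn => /mulg1_eq; rewrite invgK => ->.
  move/fN: Nb; rewrite gmulfM gmulfV gmulfXn => /mulg1_eq; rewrite invgK => ->.
  by rewrite mulVg.
have cC k : closed (C k).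
  have -> : C k = (fun z : G * G => z.1 ^+ p * z.2) @` (P k.+1 `*` P k.+3).
    apply/seteqP; split=> [z [x Px Pz]|_ [[x d] [/= Px Pd] <-]].
      by exists (x, (x ^+ p)^-1 * z); rewrite //= mulVKg.
    by exists x => //; rewrite mulKg.
  apply: compact_closed => //; apply: continuous_compact.
    apply: continuous_subspaceT; apply: continuousM.
      by apply: continuousX => x; exact: cvg_fst.
    by move=> x; exact: cvg_snd.
  by apply: compact_setX; apply: (subclosed_compact _ G_compact) => //;
    exact: lower_p_series_closed.
(* In the first step the commutators are controlled by the [r]-th powers, because [G] is powerful;
   for [p] = 2 a fourth power is the square of a square. *)
have C1 : P 2 `<=` C 0.
  have CX x : C 0 (x ^+ p).
    by exists x => //; rewrite mulVg; apply: subgroup1; case: (lower_p_series_normal p G 3).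
  apply: lower_p_series_min => // x g _; apply: powerful_min => // {}x.
  rewrite /r; case: eqP => // p2.
  by have -> : x ^+ 4 = (x ^+ p) ^+ p by rewrite p2 -expgnA.
(* For a generator [[~ x, g]], write [x] as [u ^+ p * d] by induction; modulo [P k.+4] the factor
   [d] is negligible and the commutator becomes [[~ u, g] ^+ p]. *)
have main k : P k.+2 `<=` C k.
  elim: k => // k IHk.
  have nN := lower_p_series_normal p G k.+4; have [sN nPN] := nN.
  apply: lower_p_series_min => // [x Px|x g /IHk[u Pu Pd]].
    by exists x => //; rewrite mulVg; exact: subgroup1.
  set d := _ * x in Pd; have -> : x = u ^+ p * d by rewrite mulVKg.
  have Pc : P k.+2 [~ u, g] by exact: lower_p_seriesR.
  exists [~ u, g] => //.
  have [Q [f fN]] := quotient_group nN; apply/fN.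
  rewrite gmulfM gmulfV gmulfXn; set c := [~ u, g] in Pc *.
  have fdg : f d ^ f g = f d.
    by apply/conjg_fixP/eqP; rewrite -gmulfR; apply/fN; apply: lower_p_seriesR.
  have /fN := @expgM_lower_p_series k.+2 u c isT Pc.
  rewrite gmulfM gmulfV => /mulg1_eq; rewrite invgK -conjg_commg => e; clearbody c d.
  have -> : f [~ u ^+ p * d, g] = f c ^+ p.
    rewrite gmulfR gmulfM commgEl conjMg fdg -gmulfJ conjXg -e !(gmulfM, gmulfXn) invgM.
    have fdu : commute (f d) (f c ^+ p).
      apply/commute_sym; rewrite -gmulfXn; apply/commgP/eqP; rewrite -gmulfR; apply/fN.
      by apply: lower_p_seriesR => //; apply: lower_p_seriesX.
    by rewrite -!mulgA mulKg -fdu mulKg.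
  by rewrite mulVg.
by move/main.
Qed.


(** Taking [p]-th powers maps the cosets of [P i.+1] in [P i] onto those of [P i.+2] in [P i.+1].
    Both sets are finite of the same size, so this map is injective. *)
Lemma lower_p_series_root_unit i x : (0 < i)%N ->
    finite_set (cosets (P i) (P i.+1)) ->
    (cosets (P i.+1) (P i.+2) #= cosets (P i) (P i.+1))%card ->
  P i x -> P i.+2 (x ^+ p) -> P i.+1 x.
Proof.
move=> i0 finC eqC Px Pxp.
have [sP0 _] := lower_p_series_normal p G i.
have [sP1 _] := lower_p_series_normal p G i.+1.
have nP2 := lower_p_series_normal p G i.+2; have [sP2 _] := nP2.
pose h (X : set G) := [set z | exists2 x, X x & P i.+2 ((x ^+ p)^-1 * z)].
have hE a : h (mulset [set a] (P i.+1)) = mulset [set a ^+ p] (P i.+2).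
  apply/seteqP; split=> [z [y /mulset1P Py Pz]|z /mulset1P Pz]; last first.
    by exists a => //; apply/mulset1P; rewrite mulVg; exact: subgroup1.
  apply/mulset1P; have [Q [f fN]] := quotient_group nP2; apply/fN.
  move/fN: Pz; rewrite !(gmulfM, gmulfV) => /mulg1_eq; rewrite invgK => <-.
  set c := a^-1 * y in Py; have -> : y = a * c by rewrite mulVKg.
  have /fN := @expgM_lower_p_series i a c i0 (lower_p_series_le (leqnSn _) Py).
  rewrite gmulfM gmulfV => /mulg1_eq; rewrite invgK => <-.
  rewrite gmulfM mulKg; apply/fN; exact: lower_p_seriesX.
have hC : h @` cosets (P i) (P i.+1) = cosets (P i.+1) (P i.+2).
  apply/seteqP; split=> [_ [_ [a Pa <-] <-]|_ [b Pb <-]].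
    by rewrite hE; exists (a ^+ p) => //; exact: lower_p_seriesX.
  have [a Pa Pab] := lower_p_series_root_mod i0 Pb.
  exists (mulset [set a] (P i.+1)); first by exists a.
  by rewrite hE; apply/mulset1_eq.
have := @eq_card_image_inj _ _ h finC; rewrite hC => /(_ eqC).
have inC a : P i a -> mulset [set a] (P i.+1) \in cosets (P i) (P i.+1).
  by move=> Pa; rewrite inE; exists a.
move=> /(_ _ _ (inC _ (subgroup1 sP0)) (inC _ Px)); rewrite !hE expg1n => inj.
have /inj/(mulset1_eq _ _ sP1) : mulset [set 1] (P i.+2) = mulset [set x ^+ p] (P i.+2).
  by apply/mulset1_eq; rewrite // invg1 mul1g.
by rewrite invg1 mul1g.
Qed.

(** Modulo [P 2] the group is abelian of exponent [p], so the subgroup generated by [X] meets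
    finitely many cosets. Their union is closed, hence contains the closure of that subgroup. *)
Lemma topologically_fg_cosets : topologically_fg G -> exists s : seq G,
  forall x, exists2 u, u \in s & P 2 (u^-1 * x).
Proof.
move=> [X /finite_seqP[s ->] clX].
have nP := lower_p_series_normal p G 2; have [sP _] := nP.
have [Q [f fN]] := quotient_group nP.
have fP x y : P 2 (x^-1 * y) <-> f x = f y.
  rewrite -fN gmulfM gmulfV; split=> [/mulg1_eq|->]; rewrite ?invgK // mulVg //.
have fC x y : commute (f x) (f y).
  by apply/commgP/eqP; rewrite -gmulfR; apply/fN; apply: lower_p_seriesR.
have fp x : f x ^+ p = 1 by rewrite -gmulfXn; apply/fN; apply: lower_p_seriesX.
pose D (t : seq G) := [set x | exists2 u, u \in t & f u = f x].
suff [t sD st] : exists2 t, subgroup (D t) & forall a, a \in s -> D t a.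
  exists t => x; have : closure (generated [set` s]) x by rewrite clX.
  move: x; apply: (@closure_min _ _ [set x | exists2 u, u \in t & P 2 (u^-1 * x)]).
    have -> : [set x | exists2 u, u \in t & P 2 (u^-1 * x)] =
        \bigcup_(u in [set` t]) [set x | P 2 (u^-1 * x)] by [].
    apply: closed_bigcup; first exact: finite_seq.
    move=> u _; apply: closed_preimage; last exact: lower_p_series_closed.
    by apply: continuousM; [exact: continuous_cst|exact: continuous_id].
  have -> : [set x | exists2 u, u \in t & P 2 (u^-1 * x)] = D t.
    by apply/seteqP; split=> x [u tu /fP ?]; exists u => //; apply/fP.
  by apply: generated_min => // x /= /st; rewrite inE.
elim: s {clX} => [|a s [t sD st]].
  exists [:: 1] => //; apply/subgroupP; split=> [|x y [u + eu] [v + ev]]; first by exists 1; rewrite ?inE.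
  by rewrite !inE => /eqP eu1 /eqP ev1; exists 1; rewrite ?inE // gmulfM gmulfV -eu -ev eu1 ev1 gmulf1 mulgV.
pose t' := [seq a ^+ i * u | i <- iota 0 p, u <- t].
have p0 := prime_gt0 p_prime.
have in_t' i u : (i < p)%N -> u \in t -> a ^+ i * u \in t'.
  by move=> ip tu; apply/allpairsP; exists (i, u); rewrite mem_iota.
have DM i x : D t x -> D t' (a ^+ i * x).
  move=> [u tu eu]; exists (a ^+ (i %% p) * u); first by rewrite in_t' // ltn_mod.
  rewrite !gmulfM eu !gmulfXn {2}(divn_eq i p) expgnDr mulnC expgnA fp expg1n mul1g //.
have fD x y : f x = f y -> D t' x -> D t' y.
  by move=> e [u tu eu]; exists u => //; rewrite eu.
exists t'; last first.
  move=> b; rewrite inE => /orP[/eqP ->|/st].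
    by apply/(fD (a ^+ 1 * 1)); rewrite ?expg1 ?mulg1 //; have := DM 1%N 1 (subgroup1 sD); rewrite ?mulg1.
  by move/(DM 0); rewrite mul1g.
apply/subgroupP; split=> [|x y].
  by have := DM 0 1 (subgroup1 sD); rewrite mul1g.
move=> [_ /allpairsP[[i u] /= [_ tu ->]] eu] [_ /allpairsP[[j v] /= [jp tv ->]] ev].
have jp' : (j <= p)%N by move: jp; rewrite mem_iota => /ltnW.
have Duv : D t (u / v) by apply: (subgroupF sD); [exists u|exists v].
apply: fD (DM (i + (p - j)) _ Duv); rewrite !gmulfM !gmulfV -eu -ev !(gmulfM, gmulfV, gmulfXn).
rewrite expgnDr expgnFr // fp mul1g invgM -!mulgA; congr (_ * _).
rewrite -gmulfXn -!gmulfV (mulgA (f _) (f u)) (fC _ u) -!mulgA; congr (_ * _).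
exact: fC.
Qed.

End PowerfulGroups.

Lemma coset_index (G : groupType) (N : set G) (m : nat) : subgroup N ->
    (cosets [set: G] N #= `I_m)%card ->
  exists idx : G -> 'I_m, (forall i, exists x, idx x = i) /\
    forall x y, idx x = idx y <-> N (x^-1 * y).
Proof.
move=> sN /card_set_bijP[F [Fsub Finj Fsurj]].
have inC x : cosets [set: G] N (mulset [set x] N) by exists x.
pose idx x : 'I_m := Ordinal (Fsub _ (inC x)).
exists idx; split.
  move=> i; have [|X [x _ eX] Fi] := Fsurj i; first exact: ltn_ord.
  by exists x; apply: val_inj; rewrite /= eX.
move=> x y; rewrite -(mulset1_eq x y sN); split=> [/(congr1 val)|e]; last first.
  by apply: val_inj; rewrite /= e.
by apply: Finj; rewrite inE.
Qed.

(** * The lower p-series has trivial intersection *)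

Section Residual.
Import finset fingroup perm pgroup.
Import boolp classical_sets functions cardinality topology.
Local Open Scope classical_set_scope.
Local Open Scope group_scope.
Variables (p : nat) (G : topologicalGroupType).
Local Notation P := (lower_p_series p G).
Hypotheses (p_prime : prime p) (G_pro_p : pro_p p G).

(** The core of an open subgroup [K] avoiding [x] serves. Its complement is the projection of the
    compact set of pairs (y, g) with [y ^ g] outside [K], hence closed. *)
Lemma open_normal_separation (x : G) : x <> 1 ->
  exists N : set G, [/\ open N, normal_subgroup N & ~ N x].
Proof.
move=> x1; have [[cG hG pG] _] := G_pro_p.
have [|K [sK oK Kx]] := pG (~` [set x]).
  apply: open_nbhs_nbhs; split; last by move=> /= /esym.
  by apply: closed_openC; apply: accessible_closed_set1; exact: hausdorff_accessible.
pose V := [set y | forall g, K (y ^ g)].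
have VC : ~` V = fst @` [set z : G * G | ~ K (z.1 ^ z.2)].
  apply/seteqP; split=> [y /existsNP[g nK]|_ [[y g] /= nK <-] Vy]; last exact: nK.
  by exists (y, g).
exists V; split.
- rewrite -(setCK V); apply: closed_openC; rewrite VC.
  apply: compact_closed => //; apply: continuous_compact.
    by apply: continuous_subspaceT => z; exact: cvg_fst.
  apply: (subclosed_compact _ (compact_setX cG cG)); last by [].
  have cJ : continuous (fun z : G * G => z.1 ^ z.2).
    by apply: continuousJ => z; [exact: cvg_fst|exact: cvg_snd].
  exact: (continuous_closedP _).1 cJ _ (open_closedC oK).
- split; last by move=> a b Va g; rewrite -conjgM.
  apply/subgroupP; split=> [g|a b Va Vb g]; first by rewrite conj1g; exact: subgroup1.
  by rewrite conjMg conjVg; apply: (subgroupF sK).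
- by move=> /(_ 1); rewrite conjg1 => /Kx /(_ erefl).
Qed.

(** Translations of the cosets of [N] form a finite [p]-group [Q] with kernel [N]. Each further term
    of the series is mapped into a strictly smaller normal subgroup of [Q], until the image is
    trivial. *)
Lemma lower_p_series_open_normal (N : set G) :
  open N -> normal_subgroup N -> exists i, P i.+1 `<=` N.
Proof.
move=> oN nN; have [sN cN] := nN; have [_ /(_ _ oN (normal_subgroup_in nN))[k]] := G_pro_p.
set m := (p ^ k)%N => /(coset_index sN)[idx [idx_surj idxP]].
have [f fK] := choice idx_surj.
(* The inverse is taken because permutations are composed from left to right; thus [phi] is
   multiplicative. *)
pose phi0 g (i : 'I_m) : 'I_m := idx (g^-1 * f i).
have phi0M g h i : phi0 (g * h) i = phi0 h (phi0 g i).
  rewrite /phi0 (invgM g h) -mulgA; set u := g^-1 * f i.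
  by apply/idxP; rewrite invgM invgK mulgA mulgK; apply/idxP; rewrite fK.
have phi01 g i : N g -> phi0 g i = i.
  move=> Ng; rewrite -[RHS]fK; apply/idxP; rewrite invgM invgK -mulgA -conjgE.
  exact: cN.
have phi0I g : injective (phi0 g).
  by apply: (can_inj (g := phi0 g^-1)) => i; rewrite -phi0M mulgV phi01 //; exact: subgroup1.
pose phi g : {perm 'I_m} := perm (@phi0I g).
have phiM g h : phi (g * h) = phi g * phi h.
  by apply/permP => i; rewrite permM !permE phi0M.
have phi1 g : phi g = 1 <-> N g.
  split=> [e|Ng]; last by apply/permP => i; rewrite permE perm1 phi01.
  have := congr1 (fun s : {perm 'I_m} => s (idx 1)) e.
  rewrite permE perm1 /phi0; move: (fK (idx 1)); set i := idx 1; set u := f i => /idxP Nu.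
  move=> /idxP; rewrite invgM invgK mulg1 => Nug.
  rewrite mulg1 in Nu; rewrite -[g](mulVKg u); apply: (subgroupM sN) => //.
  by rewrite -[u]invgK; apply: (subgroupV sN).
have phiV g : phi g^-1 = (phi g)^-1.
  by apply/eqP; rewrite eq_sym eq_invg_mul -phiM mulgV; apply/eqP/phi1; exact: subgroup1.
pose Q := [set s : {perm 'I_m} | `[< exists g, phi g = s >]]%SET.
have inQ s : reflect (exists g, phi g = s) (s \in Q) by rewrite finset.inE; exact: asboolP.
have gQ : group_set Q.
  apply/group_setP; split; first by apply/inQ; exists 1; apply/phi1; exact: subgroup1.
  by move=> _ _ /inQ[g <-] /inQ[h <-]; apply/inQ; exists (g * h).
have cardQ : #|Q| = m.
  have -> : Q = ((phi \o f) @: 'I_m)%SET.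
    apply/finset.setP => s; apply/inQ/imsetP => [[g <-]|[i _ ->]]; last by exists (f i).
    exists (idx g) => //; apply/eqP; rewrite /= eq_mulVg1 -phiV -phiM; apply/eqP/phi1/idxP.
    by rewrite fK.
  rewrite card_imset ?card_ord // => i j /= e.
  rewrite -(fK i) -(fK j); apply/idxP/phi1; rewrite phiM phiV e; exact: mulVg.
have pQ : p.-group (Group gQ) by rewrite /pgroup cardQ pnatX pnat_id.
have main n (M : {group {perm 'I_m}}) j : (#|M| <= n)%N -> M <| Group gQ ->
    (forall x, P j.+1 x -> phi x \in M) -> exists i, P i.+1 `<=` N.
  elim: n M j => [|n IHn] M j; first by rewrite leqNgt cardG_gt0.
  move=> Mn nM PM; have [M1|M1] := eqVneq (M : {set _}) 1.
    by exists j => x /PM; rewrite M1 => /set1P/phi1.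
  have [M' [ltM' nM' MX MR]] := p_group_lower_step p_prime pQ nM M1.
  apply: (IHn M' j.+1) => //; first by rewrite -ltnS (leq_trans (proper_card ltM')).
  suff: P j.+2 `<=` [set x | phi x \in M'] by [].
  have phiX x i : phi (x ^+ i) = phi x ^+ i.
    elim: i => [|i IHi]; first by rewrite !expg0; apply/phi1; exact: subgroup1.
    by rewrite !expgS phiM IHi.
  apply: lower_p_series_min => // [||x /PM Mx|x g /PM Mx] /=.
  - apply/subgroupP; split=> /= [|x y Mx My]; last by rewrite phiM phiV groupM ?groupV.
    by have -> : phi 1 = 1 by apply/phi1; exact: subgroup1.
  (* Since [N] is open, a point of the closure agrees modulo [N] with a point of the set. *)
  - move=> x /(_ [set y | N (x^-1 * y)]) [|y [/= My]].
      apply: open_nbhs_nbhs; split; last by rewrite /= mulVg; exact: subgroup1.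
      suff /continuousP/(_ _ oN) : continuous (fun y : G => x^-1 * y) by [].
      by apply: continuousM; [exact: continuous_cst|exact: continuous_id].
    by move/phi1; rewrite phiM phiV => /mulg1_eq; rewrite invgK => ->.
  - by rewrite phiX MX.
  - have -> : phi [~ x, g] = [~ phi x, phi g] by rewrite !commgEl !conjgE !phiM !phiV.
    by apply: MR => //; apply/inQ; exists g.
by apply: (main _ (Group gQ) 0 (leqnn _) (normal_refl _)) => x _; apply/inQ; exists x.
Qed.

Lemma lower_p_series_separation (x : G) : (forall i, P i.+1 x) -> x = 1.
Proof.
move=> Px; apply: contrapT => /open_normal_separation[N [oN nN]]; apply.
by have [i] := lower_p_series_open_normal oN nN; apply.
Qed.

End Residual.

(** Any cluster point of a sequence of points chosen in the [C n] lies in all of them. *)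
Lemma compact_nested_closed (T : topologicalType) (C : nat -> set T) :
    compact [set: T] -> (forall n, closed (C n)) -> (forall n, C n !=set0) ->
    (forall n, C n.+1 `<=` C n) ->
  exists x, forall n, C n x.
Proof.
move=> cT cC /choice[u Cu] decC.
have Cle m n : (m <= n)%N -> C n `<=` C m.
  by move=> /subnK <-; elim: (n - m)%N => // k IHk; apply: subset_trans IHk; rewrite addSn.
have [|x [_ clx]] := cT (u @ \oo) _; first exact: filterT.
exists x => n; apply: cC => B nB; have := clx (C n) B; apply => //.
by exists n => // m /= nm; apply: Cle nm _ (Cu m).
Qed.

(** * Roots and congruences in uniform groups *)

Section Uniform.
Variables (p : nat) (G : topologicalGroupType).
Local Notation P := (lower_p_series p G).
Hypotheses (p_prime : prime p) (G_uniform : uniform_pro_p p G).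

Let G_powerful : powerful p G. Proof. by case: G_uniform. Qed.
Let G_pro_p : pro_p p G. Proof. by case: G_uniform. Qed.
Let G_compact : compact [set: G]. Proof. by case: G_pro_p => -[]. Qed.
Let G_hausdorff : hausdorff_space G. Proof. by case: G_pro_p => -[]. Qed.
Let sP i : subgroup (P i). Proof. by case: (lower_p_series_normal p G i). Qed.

Lemma uniform_cosets : exists s : seq G, forall x, exists2 u, u \in s & P 2 (u^-1 * x).
Proof. by apply: topologically_fg_cosets => //; case: G_uniform. Qed.

Lemma uniform_power_unit i x : (0 < i)%N -> P i x -> P i.+2 (x ^+ p) -> P i.+1 x.
Proof.
move=> i0; have [_ _ _ eqC] := G_uniform.
have finG : finite_set (cosets [set: G] (P 2)).
  have [s sG] := uniform_cosets.
  apply: (@sub_finite_set _ _ ((fun u => mulset [set u] (P 2)) @` [set` s])); last first.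
    by apply: finite_image; exact: finite_seq.
  move=> _ [z _ <-]; have [u su Pu] := sG z; exists u => //.
  exact/mulset1_eq.
apply: lower_p_series_root_unit => //; first by rewrite (eq_finite_set (eqC _ i0)).
by apply: card_eq_trans (eqC i.+1 isT) _; rewrite card_eq_sym; apply: eqC.
Qed.

(** Successive approximation: a root modulo one term of the series is corrected by an approximate
    root of the error. Compactness gives a common solution of all the congruences, and it is exact
    because the terms intersect trivially. *)
Lemma uniform_root i y : (0 < i)%N -> P i.+1 y -> exists2 x, P i x & x ^+ p = y.
Proof.
move=> i0 Py; pose C n := [set x | P i x /\ P (i + n).+1 ((x ^+ p)^-1 * y)].
have [||n x [Px]|x Cx] := compact_nested_closed (C := C) G_compact.
- move=> n; apply: closedI; first exact: lower_p_series_closed.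
  apply: closed_preimage; last exact: lower_p_series_closed.
  apply: continuousM; last exact: continuous_cst.
  by apply: continuousV; apply: continuousX; exact: continuous_id.
- elim=> [|n [x [Px Pxy]]].
    by exists 1; split; [exact: subgroup1|rewrite expg1n invg1 mul1g addn0].
  have in0 : (0 < i + n)%N by rewrite addn_gt0 i0.
  have [c Pc] := lower_p_series_root_mod p_prime G_powerful G_compact G_hausdorff in0 Pxy.
  move=> Pcd; exists (x * c); split.
    by apply: subgroupM => //; apply: lower_p_series_le Pc; rewrite leq_addr.
  have := @expgM_lower_p_series _ _ p_prime G_powerful _ x c in0 Pc.
  rewrite addnS => /(subgroupV (sP _)); rewrite invgM invgK => Pxc.
  by have := subgroupM (sP _) Pxc Pcd; rewrite !mulgA !mulgK.
- by rewrite addnS => Pxy; split=> //; apply: lower_p_series_le Pxy.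
exists x; first by case: (Cx 0).
apply: (mulgI (x ^+ p)^-1); rewrite mulVg; apply/esym/(lower_p_series_separation p_prime G_pro_p) => n.
by have [_] := Cx n; apply: lower_p_series_le; rewrite ltnS leq_addl.
Qed.

(** With [c] the quotient of [y] by [x], the power [(x * c) ^+ p] is [x ^+ p * c ^+ p] up to two
    terms beyond that of [c]. From left to right, [c] moves down one term at a time by
    [uniform_power_unit]. *)
Lemma uniform_power_mod k x y : (0 < k)%N ->
  P k.+1 ((x ^+ p)^-1 * y ^+ p) <-> P k (x^-1 * y).
Proof.
have expgM_f j c (Q : groupType) (f : UMagmaMorphism.type G Q) :
    (forall x, f x = 1 <-> P j.+2 x) -> (0 < j)%N -> P j c ->
    f ((x * c) ^+ p) = f (x ^+ p) * f (c ^+ p).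
  move=> fN j0 Pc; have := @expgM_lower_p_series _ _ p_prime G_powerful _ x c j0 Pc.
  by move/fN; rewrite gmulfM gmulfV => /mulg1_eq; rewrite invgK gmulfM.
move=> k0; set c := x^-1 * y; have -> : y = x * c by rewrite mulVKg.
split=> [Pk|Pc]; last first.
  have [Q [f fN]] := quotient_group (lower_p_series_normal p G k.+2).
  have Pcp : P k.+1 (c ^+ p) by exact: lower_p_seriesX.
  set d := _ * (x * c) ^+ p; have : f d = f (c ^+ p).
    by rewrite /d gmulfM gmulfV (expgM_f k) // mulKg.
  move=> e; have : P k.+2 ((c ^+ p)^-1 * d) by apply/fN; rewrite gmulfM gmulfV e mulVg.
  by move/(lower_p_series_le (leqnSn _)) => Pd; apply: (in_coset (sP _) Pd Pcp).
suff main j : (j < k)%N -> P j.+1 c by case: (k) k0 (main k.-1) => // k' _; apply=> /=.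
elim: j => [|j IHj] jk //; have Pc := IHj (ltnW jk).
apply: uniform_power_unit => //.
have [Q [f fN]] := quotient_group (lower_p_series_normal p G j.+3).
apply/fN; have := expgM_f j.+1 c Q f fN isT Pc.
move/lower_p_series_le: Pk => /(_ j.+3) Pk; rewrite ltnS in Pk; move/fN: (Pk jk).
by rewrite gmulfM gmulfV => /mulg1_eq; rewrite invgK => <- /(canLR (mulKg _)); rewrite mulVg.
Qed.

Lemma uniform_torsion (x : G) : x ^+ p = 1 -> x = 1.
Proof.
move=> xp; apply: (lower_p_series_separation p_prime G_pro_p); elim=> // i IHi.
by apply: uniform_power_unit => //; rewrite xp; exact: subgroup1.
Qed.

Lemma lower_p_seriesXn n k x : (0 < k)%N -> P k x -> P (k + n) (x ^+ (p ^ n)).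
Proof.
move=> k0 Px; elim: n => [|n IHn]; first by rewrite addn0.
by rewrite addnS expnSr expgnA; apply: lower_p_seriesX; rewrite ?addn_gt0 ?k0.
Qed.

Lemma uniform_root_iter n k y : (0 < k)%N -> P (k + n) y ->
  exists2 x, P k x & x ^+ (p ^ n) = y.
Proof.
move=> k0; elim: n y => [|n IHn] y; first by rewrite addn0; exists y.
rewrite addnS => /uniform_root[|z Pz <-]; first by rewrite addn_gt0 k0.
by have [x Px <-] := IHn z Pz; exists x; rewrite // expnSr expgnA.
Qed.

Lemma uniform_power_mod_iter n k x y : (0 < k)%N ->
  P (k + n) ((x ^+ (p ^ n))^-1 * y ^+ (p ^ n)) <-> P k (x^-1 * y).
Proof.
move=> k0; elim: n => [|n IHn]; first by rewrite addn0.
by rewrite addnS expnSr !expgnA uniform_power_mod // addn_gt0 k0.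
Qed.

End Uniform.

End UniformGroups.

(** * The additive group of a uniform group *)

Section LieLattice.
Local Open Scope classical_set_scope.
Local Open Scope group_scope.

Section AdditiveGroup.
Variables (p : nat) (G : topologicalGroupType).
Local Notation P := (lower_p_series p G).
Hypotheses (p_prime : prime p) (G_uniform : uniform_pro_p p G).
Let sP i : subgroup (P i). Proof. by case: (lower_p_series_normal p G i). Qed.

(** The series [P] is numbered from 1, so [P n.*2.+1] is the G_(2n) above. This modulus suits two
    needs: the [p ^ n]-th powers commute modulo it, and taking [p ^ n]-th roots still leaves a
    congruence modulo [P n.+1], so that [z] is unique. *)
Let is_sum x y z := forall n,
  P n.*2.+1 ((x ^+ (p ^ n) * y ^+ (p ^ n))^-1 * z ^+ (p ^ n)).

Let PT n (x : G) : P n.+1 (x ^+ (p ^ n)).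
Proof. by rewrite -add1n; apply: lower_p_seriesXn. Qed.

Let PC n (x y : G) : P n.*2.+2 [~ x ^+ (p ^ n), y ^+ (p ^ n)].
Proof. by have := lower_p_seriesRR (ltn0Sn n) (ltn0Sn n) (PT n x) (PT n y); rewrite addSn addnS addnn. Qed.

Let fC n (Q : groupType) (f : UMagmaMorphism.type G Q) x y :
  (forall x, f x = 1 <-> P n.*2.+1 x) -> commute (f x ^+ (p ^ n)) (f y ^+ (p ^ n)).
Proof.
move=> fN; rewrite -!gmulfXn; apply/commgP/eqP; rewrite -gmulfR; apply/fN.
exact: lower_p_series_le (leqnSn _) _ (@PC n _ _).
Qed.

Let is_sumP x y z n (Q : groupType) (f : UMagmaMorphism.type G Q) :
  (forall x, f x = 1 <-> P n.*2.+1 x) -> is_sum x y z ->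
  f z ^+ (p ^ n) = f x ^+ (p ^ n) * f y ^+ (p ^ n).
Proof.
move=> fN /(_ n)/fN; rewrite gmulfM gmulfV => /mulg1_eq.
by rewrite invgK gmulfM !gmulfXn.
Qed.

Let is_sum_intro x y z :
  (forall n (Q : groupType) (f : UMagmaMorphism.type G Q),
    (forall x, f x = 1 <-> P n.*2.+1 x) ->
    f z ^+ (p ^ n) = f x ^+ (p ^ n) * f y ^+ (p ^ n)) -> is_sum x y z.
Proof.
move=> H n; have [Q [f fN]] := quotient_group (lower_p_series_normal p G n.*2.+1).
by apply/fN; rewrite gmulfM gmulfV gmulfM !gmulfXn (H n Q f) // mulVg.
Qed.

Let is_sum_inj x y z z' : is_sum x y z -> is_sum x y z' -> z = z'.
Proof.
move=> Pz Pz'; apply: (mulgI z^-1); rewrite mulVg.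
apply/esym/(lower_p_series_separation p_prime) => [|n]; first by case: G_uniform.
apply/(uniform_power_mod_iter p_prime G_uniform n) => //.
have [Q [f fN]] := quotient_group (lower_p_series_normal p G n.*2.+1).
rewrite addSn addnn; apply/fN; rewrite gmulfM gmulfV !gmulfXn.
by rewrite (is_sumP fN Pz) (is_sumP fN Pz') mulVg.
Qed.

(** The solutions of each congruence form a nonempty closed set. These sets decrease: [p ^ n]-th
    powers commute modulo [P n.*2.+2], so the congruence for n + 1 becomes one between [p]-th
    powers, and [p]-th roots can be taken. *)
Let is_sum_ex x y : exists z, is_sum x y z.
Proof.
have [[[G_compact _ _] _] _ _ _] := G_uniform.
pose C n := [set z | P n.*2.+1 ((x ^+ (p ^ n) * y ^+ (p ^ n))^-1 * z ^+ (p ^ n))].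
apply: (compact_nested_closed (C := C) G_compact) => n.
- apply: closed_preimage; last exact: lower_p_series_closed.
  apply: continuousM; first exact: continuous_cst.
  by apply: continuousX; exact: continuous_id.
- have Pxy : P (1 + n) (x ^+ (p ^ n) * y ^+ (p ^ n)) by apply: subgroupM => //; exact: PT.
  have [z _ ez] := uniform_root_iter p_prime G_uniform (ltn0Sn 0) Pxy.
  by exists z; rewrite /C /= ez mulVg; exact: subgroup1.
- move=> z; rewrite /C /= expnSr !expgnA; set a := x ^+ _; set b := y ^+ _ => Pz.
  apply/(uniform_power_mod p_prime G_uniform) => //.
  have [Q [f fN]] := quotient_group (lower_p_series_normal p G n.*2.+2).
  apply/fN; rewrite gmulfM gmulfV !gmulfXn gmulfM expgMn; last first.
    by apply/commgP/eqP; rewrite -gmulfR; apply/fN; exact: PC.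
  move: Pz => /(lower_p_series_le (leqnSn _))/fN.
  by rewrite gmulfM gmulfV gmulfM !gmulfXn.
Qed.

Let add x y := projT1 (cid (is_sum_ex x y)).
Let addE x y z : is_sum x y z -> add x y = z.
Proof. by move=> H; apply: (@is_sum_inj x y) => //; rewrite /add; case: cid. Qed.
Let addP x y : is_sum x y (add x y).
Proof. by rewrite /add; case: cid. Qed.

Let addC : commutative add.
Proof.
move=> x y; apply/addE/is_sum_intro => n Q f fN.
by rewrite (is_sumP fN (addP y x)) (fC _ _ fN).
Qed.

Let addA : associative add.
Proof.
move=> x y z; apply/addE/is_sum_intro => n Q f fN.
by rewrite !(is_sumP fN (addP _ _)) mulgA.
Qed.

Let add0 : left_id 1 add.
Proof.
by move=> x; apply/addE/is_sum_intro => n Q f fN; rewrite gmulf1 expg1n mul1g.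
Qed.

Let addN : left_inverse 1 (fun x => x^-1) add.
Proof.
move=> x; apply/addE/is_sum_intro => n Q f fN.
by rewrite gmulf1 expg1n gmulfV expVgn mulVg.
Qed.

(** The laws of an abelian group are checked on [p ^ n]-th powers modulo [P n.*2.+1]. By the third
    clause the cosets of [P n.+1] are those of p^n L. Conjugation is additive because the terms of
    the series are normal. *)
Lemma uniform_additive_group : exists (L : zmodType) (e : G -> L),
  [/\ bijective e, forall x n, e (x ^+ n) = (e x *+ n)%R,
      forall x y n, P n.+1 (x^-1 * y) <-> exists l, (e y - e x = l *+ p ^ n)%R &
      forall h x y z, (e z = e x + e y)%R -> (e (z ^ h)%g = e (x ^ h)%g + e (y ^ h)%g)%R].
Proof.
pose mL := GRing.isZmodule.Build G addA addC add0 addN.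
pose L : zmodType := HB.pack (TopologicalGroup.sort G) mL.
pose e (x : G) : L := x.
have addLE x y : (e x + e y)%R = e (add x y) by [].
have mulnE x n : e (x ^+ n) = (e x *+ n)%R.
  elim: n => [|n IHn]; first by [].
  rewrite GRing.mulrS -IHn addLE; congr e; apply/esym/addE/is_sum_intro => m Q f fN.
  by rewrite !gmulfXn (expgS (f x)) expgMn //; apply: commuteX.
have eP l : exists x, l = e x by exists l.
have e_bij : bijective e by exists (fun x : L => (x : G)).
have oppE x : (- e x)%R = e x^-1 by [].
have e_inj : injective e by move=> x y; exact.
(* [e] is the identity map; made opaque, it keeps the two group structures on the same set apart. *)
clearbody e; exists L, e; split; [exact: e_bij|exact: mulnE|move=> x y n|move=> h x y z ez].
- pose d := add y x^-1.
  have -> : (exists l : L, e y - e x = l *+ p ^ n)%R <-> P n.+1 (1^-1 * d).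
    rewrite invg1 mul1g oppE addLE -/d; split=> [[l]|].
      have [u ->] := eP l; rewrite -mulnE => /e_inj ->; exact: PT.
    rewrite -add1n => /(uniform_root_iter p_prime G_uniform (ltn0Sn 0))[l _ el].
    by exists (e l); rewrite -mulnE el.
  rewrite -(uniform_power_mod_iter p_prime G_uniform n x y (ltn0Sn n)).
  rewrite -(uniform_power_mod_iter p_prime G_uniform n 1 d (ltn0Sn n)) addSn addnn.
  have nP := lower_p_series_normal p G n.*2.+1; have [Q [f fN]] := quotient_group nP.
  rewrite -!fN !gmulfM !gmulfV !gmulfXn (is_sumP fN (addP _ _)) gmulf1 !expg1n invg1 mul1g.
  rewrite gmulfV expVgn.
  split=> [/mulg1_eq|/divg1_eq->]; last by rewrite mulVg.
  by rewrite invgK => ->; rewrite mulgV.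
- have ez' : z = add x y by apply: e_inj; rewrite ez addLE.
  rewrite addLE; congr e; apply/esym/addE => n.
  have := addP x y; rewrite -ez' => /(_ n).
  have [_ cP] := lower_p_series_normal p G n.*2.+1 => /(cP _ h).
  by rewrite !(conjMg, conjVg, conjXg).
Qed.

End AdditiveGroup.

End LieLattice.

(** * Modules with a congruence action *)

Section CongruenceModules.
Import GRing.Theory.
Local Open Scope classical_set_scope.
Local Open Scope ring_scope.

(** For such a subgroup the quotient L/U has no [p]-torsion and is [p]-adically separated. *)
Record pure (p : nat) (L : zmodType) (U : set L) : Prop := Pure {
  pure0 : U 0;
  pureB : forall x y, U x -> U y -> U (x - y);
  pure_div : forall x, U (x *+ p) -> U x;
  pure_closed : forall x, (forall n, exists u l, U u /\ x = u + l *+ p ^ n) -> U x }.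

Section PureSubgroups.
Variables (p : nat) (L : zmodType).
Implicit Types (U V W : set L).

Lemma pureN U x : pure p U -> U x -> U (- x).
Proof. by move=> pU Ux; rewrite -sub0r; apply: (pureB pU) => //; exact: pure0 pU. Qed.

Lemma pureD U x y : pure p U -> U x -> U y -> U (x + y).
Proof. by move=> pU Ux Uy; rewrite -[y]opprK; apply: (pureB pU) => //; exact: pureN. Qed.

Lemma pureMn U x n : pure p U -> U x -> U (x *+ n).
Proof.
move=> pU Ux; elim: n => [|n IHn]; first by rewrite mulr0n; exact: pure0 pU.
by rewrite mulrS; apply: pureD.
Qed.

Lemma pureMz U x n : pure p U -> U x -> U (x *~ n).
Proof.
move=> pU Ux; case: n => n; first exact: pureMn.
by rewrite NegzE mulrNz; apply: pureN => //; exact: pureMn.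
Qed.

Lemma pure_divX U x n : pure p U -> U (x *+ p ^ n) -> U x.
Proof.
move=> pU; elim: n => [|n IHn]; first by rewrite expn0 mulr1n.
by rewrite expnSr mulrnA => /(pure_div pU)/IHn.
Qed.

Lemma pure_swap U x y : pure p U -> U (x - y) -> U (y - x).
Proof. by move=> pU; rewrite -opprB => /(pureN pU); rewrite opprK. Qed.

Lemma pure_trans U y x z : pure p U -> U (x - y) -> U (y - z) -> U (x - z).
Proof. by move=> pU Uxy /(pureD pU Uxy); rewrite addrA subrK. Qed.

(** Irreducibility will be applied to such kernels of operators on W/U and to their
    intersections. *)
Lemma pure_kernel U W (s : L -> L) : (forall x y, s (x - y) = s x - s y) ->
  pure p U -> pure p W -> pure p [set w | W w /\ U (s w)].
Proof.
move=> sB pU pW; have s0 : s 0 = 0 by rewrite -{1}(subrr 0) sB subrr.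
have sD x y : s (x + y) = s x + s y.
  by rewrite -[y in LHS]opprK sB -{1}(sub0r y) sB s0 sub0r opprK.
have sM x n : s (x *+ n) = s x *+ n.
  by elim: n => [|n IHn]; rewrite ?mulr0n // !mulrS sD IHn.
split=> [|x y [Wx Ux] [Wy Uy]|x [Wx Ux]|x Wx].
- by split; [exact: pure0 pW|rewrite s0; exact: pure0 pU].
- by split; [exact: (pureB pW)|rewrite sB; exact: (pureB pU)].
- by split; [exact: pure_div pW _ Wx|apply: (pure_div pU); rewrite -sM].
- split.
    by apply: (pure_closed pW) => n; have [u [l [[Wu _] e]]] := Wx n; exists u, l.
  apply: (pure_closed pU) => n; have [u [l [[_ Uu] ->]]] := Wx n.
  by exists (s u), (s l); rewrite sD sM.
Qed.

Lemma pureI (T : Type) (D : set T) (F : T -> set L) W :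
  pure p W -> (forall t, D t -> pure p (F t)) ->
  pure p [set w | W w /\ forall t, D t -> F t w].
Proof.
move=> pW pF; split=> [|x y [Wx Fx] [Wy Fy]|x [Wx Fx]|x Wx].
- by split=> [|t /pF/pure0 //]; exact: pure0 pW.
- by split=> [|t Dt]; [exact: (pureB pW)|apply: (pureB (pF t Dt)); [exact: Fx|exact: Fy]].
- by split=> [|t Dt]; [exact: pure_div pW _ Wx|apply: (pure_div (pF t Dt)); exact: Fx].
- split=> [|t Dt].
    by apply: (pure_closed pW) => n; have [u [l [[Wu _] e]]] := Wx n; exists u, l.
  apply: (pure_closed (pF t Dt)) => n; have [u [l [[_ Fu] ->]]] := Wx n.
  by exists u, l; split=> //; exact: Fu.
Qed.

End PureSubgroups.

Lemma count_sub_eq (T : eqType) (a b : pred T) (s : seq T) :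
  subpred a b -> (count b s <= count a s)%N -> {in s, forall x, b x -> a x}.
Proof.
move=> sab; elim: s => [|y s IHs] //= ble x.
have les : (count a s <= count b s)%N by exact: sub_count.
have [ay|nay] := boolP (a y).
  rewrite ay (sab _ ay) leq_add2l in ble.
  by rewrite inE => /orP[/eqP ->|] //; apply: IHs.
rewrite (negbTE nay) in ble; case: (boolP (b y)) ble => nby ble.
  by have := leq_trans ble les; rewrite ltnn.
by rewrite inE => /orP[/eqP -> by_|]; [rewrite by_ in nby|apply: IHs].
Qed.

(** * Rank and composition series *)

Section FiniteRank.
Variables (p : nat) (L : zmodType).
Hypothesis L_fin : exists s : seq L, forall v, exists2 u, u \in s & exists l, v - u = l *+ p.
Implicit Types (U V W : set L).

(** The rank counts the members of [s] whose class modulo [p] meets [U]. If the ranks agree, [W]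
    lies in U + pL, hence in U + pW by purity of [W], hence in U + p^n W for all n, and [U] is
    closed. *)
Lemma pure_rank : exists rank : set L -> nat,
  (forall U W, U `<=` W -> rank U <= rank W)%N /\
  (forall U W, pure p U -> pure p W -> U `<=` W -> (rank W <= rank U)%N -> U = W).
Proof.
have [s sP] := L_fin.
pose a U u := `[< exists2 x, U x & exists l, x - u = l *+ p >].
have sub U W : U `<=` W -> subpred (a U) (a W).
  by move=> UW u /asboolP[x Ux e]; apply/asboolP; exists x => //; exact: UW.
exists (fun U => count (a U) s); split=> [U W /sub/sub_count //|U W pU pW UW rk].
have WU w : W w -> exists x l, [/\ U x, W l & w = x + l *+ p].
  move=> Ww; have [u su [l el]] := sP w.
  have /(count_sub_eq (sub _ _ UW) rk su)/asboolP[x Ux [l' el']] : a W u.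
    by apply/asboolP; exists w => //; exists l.
  have e : w = x + (l - l') *+ p by rewrite mulrnBl -el -el' opprB subrKA addrC subrK.
  exists x, (l - l'); split=> //; apply: (pure_div pW).
  have -> : (l - l') *+ p = w - x by rewrite [in RHS]e addrAC subrr add0r.
  by apply: (pureB pW) => //; exact: UW.
apply/seteqP; split=> // w Ww; apply: (pure_closed pU) => n.
suff [u [l [Uu _ e]]] : exists u l, [/\ U u, W l & w = u + l *+ p ^ n] by exists u, l.
elim: n => [|n [u [l [Uu Wl ->]]]].
  by exists 0, w; split=> //; [exact: pure0 pU|rewrite expn0 mulr1n add0r].
have [x [l' [Ux Wl' ->]]] := WU l Wl.
exists (u + x *+ p ^ n), l'; split=> //; first by apply: (pureD pU) => //; exact: (pureMn _ pU).
by rewrite mulrnDl addrA -mulrnA expnS.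
Qed.

Section Lattice.
Variable Inv : set L -> Prop.
Let lat U := pure p U /\ Inv U.

Definition irreducible_section U W := [/\ U `<=` W, U <> W &
  forall V, lat V -> U `<=` V -> V `<=` W -> V = U \/ V = W].

(** Strict inclusions raise the rank, so every section has a composition series; the proof splits
    sections by induction on the difference of ranks. *)
Lemma pure_lattice_ind (R : set L -> set L -> Prop) :
    (forall U, lat U -> R U U) ->
    (forall U V W, lat U -> lat V -> lat W -> U `<=` V -> V `<=` W ->
       R U V -> R V W -> R U W) ->
    (forall U W, lat U -> lat W -> irreducible_section U W -> R U W) ->
  forall U W, lat U -> lat W -> U `<=` W -> R U W.
Proof.
move=> R0 Rt Ri; have [rank [rank_le rank_eq]] := pure_rank.
suff main n U W : (rank W - rank U <= n)%N -> lat U -> lat W -> U `<=` W -> R U W.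
  by move=> U W; apply: main (leqnn _).
elim: n U W => [|n IHn] U W.
  rewrite leqn0 subn_eq0 => rk lU lW UW.
  by rewrite -(rank_eq U W lU.1 lW.1 UW rk); exact: R0.
move=> rk lU lW UW; have [e|ne] := EM (U = W); first by rewrite -e; exact: R0.
have [[V [lV [UV VW] [nVU nVW]]]|irr] :=
    EM (exists V, [/\ lat V, U `<=` V /\ V `<=` W & V <> U /\ V <> W]); last first.
  apply: Ri => //; split=> // V lV UV VW; apply: contrapT => /not_orP nV.
  by apply: irr; exists V.
have rkUV : (rank U < rank V)%N.
  by rewrite ltnNge; apply/negP => /(rank_eq _ _ lU.1 lV.1 UV) e; apply: nVU.
have rkVW : (rank V < rank W)%N.
  by rewrite ltnNge; apply/negP => /(rank_eq _ _ lV.1 lW.1 VW) e; apply: nVW.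
apply: (Rt U V W) => //; apply: IHn => //.
  rewrite -ltnS; apply: leq_trans rk; apply: ltn_sub2r => //.
  exact: ltn_trans rkUV rkVW.
rewrite -ltnS; apply: leq_trans rk; apply: ltn_sub2l => //.
exact: ltn_trans rkUV rkVW.
Qed.

Lemma pure_irreducible_ex U W : lat U -> lat W -> U `<=` W -> U <> W ->
  exists V, [/\ lat V, V `<=` W & irreducible_section U V].
Proof.
move=> lU lW UW; move: U W lU lW UW; apply: pure_lattice_ind => // [U V W lU lV lW UV VW IU IV|].
  move=> nUW; have [e|/IU[V' [lV' V'V irr]]] := EM (U = V).
    by rewrite e in nUW *; apply: IV.
  by exists V'; split=> //; apply: subset_trans VW.
by move=> U W lU lW irr _; exists W; split.
Qed.

End Lattice.
End FiniteRank.

(** The modulus 4 for [p] = 2 excludes -1, which is trivial modulo 2 and has the same square as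
    1. *)
Record congruence_action (p : nat) (L : zmodType) (G : groupType) (act : G -> L -> L) :
    Prop := CongruenceAction {
  act1 : forall v, act 1%g v = v;
  actM : forall g h v, act (g * h)%g v = act g (act h v);
  actB : forall g v w, act g (v - w) = act g v - act g w;
  act_congr : forall g v, exists l, act g v - v = l *+ (if p == 2 then 4 else p) }.

Definition act_invariant (L : zmodType) (G : groupType) (act : G -> L -> L) (M : set G)
  (U : set L) := forall g, M g -> forall x, U x -> U (act g x).

Section Action.
Variables (p : nat) (L : zmodType) (G : groupType) (act : G -> L -> L).
Hypotheses (p_prime : prime p) (Aact : congruence_action p act).

Lemma act0 g : act g 0 = 0.
Proof. by rewrite -{1}(subrr 0) (actB Aact) subrr. Qed.

Lemma actN g v : act g (- v) = - act g v.
Proof. by rewrite -sub0r (actB Aact) act0 sub0r. Qed.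

Lemma actD g v w : act g (v + w) = act g v + act g w.
Proof. by rewrite -[w in LHS]opprK (actB Aact) actN opprK. Qed.

Lemma actMn g v n : act g (v *+ n) = act g v *+ n.
Proof. by elim: n => [|n IHn]; rewrite ?mulr0n ?act0 // !mulrS actD IHn. Qed.

Lemma actMz g v n : act g (v *~ n) = act g v *~ n.
Proof. by case: n => n; rewrite ?NegzE ?mulrNz ?actN -?pmulrn actMn. Qed.

Lemma actK g : cancel (act g) (act g^-1%g).
Proof. by move=> v; rewrite -(actM Aact) mulVg (act1 Aact). Qed.

Lemma actVK g : cancel (act g^-1%g) (act g).
Proof. by move=> v; rewrite -(actM Aact) mulgV (act1 Aact). Qed.

(** * Uniqueness of roots on a section *)

Section Roots.
Variables (U W : set L).
Hypotheses (pU : pure p U) (pW : pure p W) (UW : U `<=` W).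
Variables (a b : G).
Hypotheses (aU : forall x, U x -> U (act a x)) (bU : forall x, U x -> U (act b x)).
Hypotheses (aW : forall x, W x -> W (act a x)) (bW : forall x, W x -> W (act b x)).

(** The [p]-adic neighbourhoods U + p^k W of [U] in [W]. When [U] and [W] are stable under [g], the
    operator g - 1 raises [k] by the exponent [e] of the congruence. *)
Let Y k := [set x | exists u l, [/\ U u, W l & x = u + l *+ p ^ k]].

Let YB k x y : Y k x -> Y k y -> Y k (x - y).
Proof.
move=> [u [l [Uu Wl ->]]] [v [m [Uv Wm ->]]]; exists (u - v), (l - m).
by split; [exact: (pureB pU)|exact: (pureB pW)|rewrite mulrnBl opprD addrACA].
Qed.

Let Y0 k : Y k 0.
Proof. by exists 0, 0; rewrite mul0rn addr0; split=> //; [exact: pure0 pU|exact: pure0 pW]. Qed.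

Let YD k x y : Y k x -> Y k y -> Y k (x + y).
Proof. by move=> Yx Yy; rewrite -[y]opprK -[- y]sub0r; do 2!apply: YB => //. Qed.

Let YMn k x n : Y k x -> Y k (x *+ n).
Proof. by move=> Yx; elim: n => [|n IHn]; rewrite ?mulr0n ?mulrS //; apply: YD. Qed.

Let Y_le j k x : (j <= k)%N -> Y k x -> Y j x.
Proof.
move=> jk [u [l [Uu Wl ->]]]; exists u, (l *+ p ^ (k - j)); split=> //; first exact: (pureMn _ pW).
by rewrite -mulrnA -expnD subnK.
Qed.

Let YMX k j x : Y k x -> Y (j + k) (x *+ p ^ j).
Proof.
move=> [u [l [Uu Wl ->]]]; exists (u *+ p ^ j), l; split=> //; first exact: (pureMn _ pU).
by rewrite mulrnDl -mulrnA -expnD addnC.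
Qed.

Let Y_U k x : U x -> Y k x.
Proof. by move=> Ux; exists x, 0; rewrite mul0rn addr0; split=> //; exact: pure0 pW. Qed.

Let e : nat := (if p == 2 then 2 else 1)%N.

Let e_gt0 : (0 < e)%N. Proof. by rewrite /e; case: eqP. Qed.

Let act_e g v : exists l, act g v - v = l *+ p ^ e.
Proof. by have [l ->] := act_congr Aact g v; exists l; rewrite /e; case: eqP => [->|_]; rewrite ?expn1. Qed.

Let Yact g k x : (forall x, U x -> U (act g x)) -> (forall x, W x -> W (act g x)) ->
  Y k x -> Y (k + e) (act g x - x).
Proof.
move=> gU gW [u [l [Uu Wl ->]]]; rewrite actD actMn opprD addrACA -mulrnBl.
have [m em] := act_e g l; exists (act g u - u), m.
split; first by apply: (pureB pU) => //; exact: gU.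
  by apply: (@pure_divX p _ _ _ e pW); rewrite -em; apply: (pureB pW) => //; exact: gW.
by rewrite em -mulrnA -expnD addnC.
Qed.

Let YactW g x : (forall x, U x -> U (act g x)) -> (forall x, W x -> W (act g x)) ->
  W x -> Y e (act g x - x).
Proof.
move=> gU gW Wx; rewrite -[e]add0n; apply: Yact => //.
by exists 0, x; rewrite expn0 mulr1n add0r; split=> //; exact: pure0 pU.
Qed.

Let D x := act a x - act b x.

Let D_U x : U x -> U (D x).
Proof. by move=> Ux; apply: (pureB pU); [exact: aU|exact: bU]. Qed.

Let DD x y : D (x + y) = D x + D y.
Proof. by rewrite /D !actD opprD addrACA. Qed.

Let DMn x n : D (x *+ n) = D x *+ n.
Proof. by rewrite /D !actMn mulrnBl. Qed.

Let act_subE g x : act g x = x + (act g x - x).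
Proof. by rewrite addrC subrK. Qed.

Let expand_step (r s d x y t u : L) n c :
  r + s + (d + x) *+ n + (x + y + t) *+ c + (d + y *+ n + u) =
  r + s + t *+ c + u + d *+ n.+1 + (x + y) *+ (n + c).
Proof.
rewrite mulrnDr mulrS !mulrnDl !addrA.
by rewrite [LHS](AC 10 (1*2*7*10*8*3*4*9*5*6))/=.
Qed.

(* Let [D = a - b].  If [D] maps [W] into [p^k W + U], then modulo [p^(k+2) W + U]
   [a^n - b^n = n D + C(n, 2) ((a - 1) D + D (b - 1))], where the last factor is divisible by
   [p^(k+1)], or [p^(k+2)] if [p = 2]; so [D] maps [W] into [p^(k+1) W + U]. *)
Lemma act_root n : prime n ->
    (forall w, W w -> U (act (a ^+ n)%g w - act (b ^+ n)%g w)) ->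
  forall w, W w -> U (act a w - act b w).
Proof.
move=> n_prime Hn.
suff main k : forall w, W w -> Y k (D w).
  move=> w Ww; apply: (pure_closed pU) => k.
  by have [u [l [Uu _ eD]]] := main k w Ww; exists u, l.
elim: k => [|k IHk] w Ww.
  exists 0, (D w); rewrite expn0 mulr1n add0r; split=> //; first exact: pure0 pU.
  by apply: (pureB pW); [exact: aW|exact: bW].
have DY j x : Y j x -> Y (j + k) (D x).
  move=> [u [l [Uu Wl ->]]]; rewrite DD DMn; apply: YD; first exact/Y_U/D_U.
  exact/YMX/IHk.
(* First-order expansion: b^m is 1 + m(b - 1) up to multiples of (b - 1)^2, which gains two
   congruences. *)
have bXw m : Y (e + e) (act (b ^+ m)%g w - w - (act b w - w) *+ m).
  have bw : Y e (act b w - w) by exact: YactW.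
  elim: m => [|m IHm].
    by rewrite expg0 (act1 Aact) mulr0n subr0 subrr; exact: Y0.
  rewrite expgS (actM Aact); set v := act _ w in IHm *; set d := act b w - w in IHm bw *.
  set s := v - w - d *+ m in IHm *.
  have -> : v = w + s + d *+ m by rewrite -addrA /s subrK addrC subrK.
  have -> : act b (w + s + d *+ m) - w - d *+ m.+1 =
      s + (act b s - s) + (act b d - d) *+ m.
    have bwE : act b w = w + d by rewrite /d addrC subrK.
    clearbody s d; rewrite !actD actMn bwE {1}(act_subE b s) {1}(act_subE b d).
    move: (act b s - s) (act b d - d) => s' d'.
    rewrite mulrS mulrnDl opprD !addrA.
    by rewrite [LHS](AC 9 (3*4*6*(1*7*(2*8)*(5*9))))/= !subrr !addr0.
  apply: YD; first apply: YD => //.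
    by apply: Y_le (Yact bU bW IHm); rewrite leq_addr.
  by apply: YMn; apply: Yact.
pose d := D w; pose x := act a d - d; pose y := D (act b w - w).
have Yd : Y k d by exact: IHk.
have YE : Y (k + e) (x + y).
  by apply: YD; [exact: Yact|rewrite addnC; apply/DY/YactW].
have dx : act a d = d + x by exact: act_subE.
have [Dw Dy] : D w = d /\ D (act b w - w) = y by [].
clearbody x y d.
have YT m : Y (k + e + e)
    (act (a ^+ m)%g w - act (b ^+ m)%g w - d *+ m - (x + y) *+ 'C(m, 2)).
  elim: m => [|m IHm].
    by rewrite !expg0 !mulr0n !subr0 subrr; exact: Y0.
  have [v bv Yv] : exists2 v, act (b ^+ m)%g w = w + (act b w - w) *+ m + v & Y (e + e) v.
    exists (act (b ^+ m)%g w - w - (act b w - w) *+ m); last exact: bXw.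
    move: (act _ w) (_ *+ m) => u z.
    by rewrite -(addrA u) -opprD [RHS]addrC subrK.
  rewrite !expgS !(actM Aact); move: IHm; set A := act (a ^+ m)%g w; set B := act (b ^+ m)%g w.
  set R := _ - (x + y) *+ 'C(m, 2) => YR.
  have TE : A - B = R + d *+ m + (x + y) *+ 'C(m, 2).
    by rewrite addrAC /R subrK subrK.
  clearbody R.
  have -> : act a A - act b B = act a (A - B) + D B.
    by rewrite (actB Aact) /D addrA subrK.
  have DBE : D B = d + y *+ m + D v by rewrite /B bv !DD DMn Dw Dy.
  rewrite DBE TE actD (actD a R) !actMn dx.
  pose t := act a (x + y) - (x + y).
  have -> : act a R = R + (act a R - R) by exact: act_subE.
  have -> : act a (x + y) = x + y + t by exact: act_subE.
  rewrite expand_step binS bin1 [(_ + m)%N]addnC addrAC !addrK.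
  have Yt : Y (k + e + e) t by exact: Yact.
  apply: YD; last by have := DY _ _ Yv; rewrite addnC addnA.
  apply: YD; last exact: YMn.
  apply: YD => //; apply: Y_le (Yact aU aW YR); exact: leq_addr.
have nY : Y (k + e + e) (d *+ n + (x + y) *+ 'C(n, 2)).
  have := YB (Y_U _ (Hn w Ww)) (YT n).
  move: (act _ w - act _ w) => T.
  by rewrite !opprB addrC -addrA subrK addrC.
have Yk1 z j : Y j z -> (k.+1 <= j)%N -> Y k.+1 z by move=> Yz kj; exact: Y_le Yz.
have ke : (k.+1 <= k + e)%N by rewrite -addn1 leq_add2l.
(* If [n] differs from [p], then n d and p d lie in [Y k.+1], and so does [d] by Bezout. If they are
   equal, p d lies in [Y k.+2] and is divided by [p] using the purity of [U]. *)
rewrite Dw; have [np|np] := eqVneq n p; last first.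
  have Ynd : Y k.+1 (d *+ n).
    rewrite -[d *+ n](addrK ((x + y) *+ 'C(n, 2))); apply: YB.
      by apply: Yk1 nY _; rewrite (leq_trans ke) ?leq_addr.
    by apply: YMn; apply: Yk1 YE ke.
  have Ypd : Y k.+1 (d *+ p) by have := YMX 1 Yd; rewrite expn1 add1n.
  have [u v e1 _] := egcdnP p (prime_gt0 n_prime).
  have -> : d = d *+ (u * n) - d *+ (v * p).
    rewrite e1; have -> : gcdn n p = 1%N by apply/eqP; rewrite -/(coprime n p) prime_coprime // dvdn_prime2.
    by rewrite mulrnDr addrC addKr.
  by apply: YB; rewrite mulnC mulrnA; exact: YMn.
suff : Y k.+2 (d *+ p).
  move=> [u [l [Uu Wl el]]]; exists (d - l *+ p ^ k.+1), l; split=> //; last by rewrite subrK.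
  by apply: (pure_div pU); rewrite mulrnBl el -mulrnA -expnSr addrK.
have e2 : Y k.+2 ((x + y) *+ 'C(n, 2)).
  have [p2|p2] := eqVneq p 2%N.
    by apply: YMn; apply: Y_le YE; rewrite /e p2 eqxx addn2.
  have /dvdnP[c ->] : (p %| 'C(n, 2))%N.
    by rewrite np; apply: prime_dvd_bin => //=; rewrite ltn_neqAle eq_sym p2 prime_gt1.
  rewrite mulrnA; have := YMX 1 (YMn c YE); rewrite expn1; apply: Y_le; rewrite add1n ltnS.
  exact: ke.
rewrite -np -[d *+ n](addrK ((x + y) *+ 'C(n, 2))); apply: YB => //.
by apply: Y_le nY; rewrite -addnA -addn2 leq_add2l; exact: (leq_add e_gt0 e_gt0).
Qed.

End Roots.
End Action.

Section Action.
Variables (p : nat) (L : zmodType) (G : groupType) (act : G -> L -> L).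
Hypotheses (p_prime : prime p) (Aact : congruence_action p act).

Lemma act_sum g (I : Type) (r : seq I) (F : I -> L) :
  act g (\sum_(i <- r) F i) = \sum_(i <- r) act g (F i).
Proof. exact: (big_morph _ (actD Aact g) (act0 Aact g)). Qed.

Lemma act_stableX g n (U : set L) : (forall x, U x -> U (act g x)) ->
  forall x, U x -> U (act (g ^+ n)%g x).
Proof.
move=> gU x Ux; elim: n => [|n IHn]; first by rewrite expg0 (act1 Aact).
by rewrite expgS (actM Aact); exact: gU.
Qed.

Lemma act_root_gt0 (U W : set L) (a b : G) n : pure p U -> pure p W ->
    (forall x, U x -> U (act a x)) -> (forall x, U x -> U (act b x)) ->
    (forall x, W x -> W (act a x)) -> (forall x, W x -> W (act b x)) ->
    (0 < n)%N -> (forall w, W w -> U (act (a ^+ n)%g w - act (b ^+ n)%g w)) ->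
  forall w, W w -> U (act a w - act b w).
Proof.
move=> pU pW aU bU aW bW; have [m] := ubnP n; elim: m n => // m IHm n ltnm n0 Hn.
have [n1|n1] := leqP n 1.
  have e : n = 1%N by apply/eqP; rewrite eqn_leq n1.
  by move: Hn; rewrite e.
have q_prime := pdiv_prime n1; have q_dvd := pdiv_dvd n.
pose k := (n %/ pdiv n)%N; have nE : n = (k * pdiv n)%N by rewrite divnK.
apply: (IHm k).
- by rewrite ltnS in ltnm; apply: leq_trans ltnm; rewrite ltn_Pdiv // prime_gt1.
- by rewrite divn_gt0 ?pdiv_gt0 // dvdn_leq.
- apply: (act_root p_prime Aact pU pW _ _ _ _ q_prime); try exact: act_stableX.
  by move=> w Ww; rewrite -!expgnA -nE; exact: Hn.
Qed.

(** * Characteristic polynomials modulo powers of p *)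

Section CharacteristicPolynomial.
Hypothesis L_fin : exists s : seq L, forall v, exists2 u, u \in s & exists l, v - u = l *+ p.

Lemma finite_span_mod : exists (d : nat) (e : 'I_d.+1 -> L), forall n v,
  exists (c : 'rV[int]_d.+1) l, v = \sum_i e i *~ c 0 i + l *+ p ^ n.
Proof.
(* The family has one member more than [s], the default 0; thus the matrices on it have positive
   size. *)
have [s sP] := L_fin; exists (size s); exists (fun i => nth 0 s i).
elim=> [|n IHn] v.
  exists 0, v; rewrite big1 ?add0r ?expn0 ?mulr1n // => i _.
  by rewrite mxE mulr0z.
have [c [l ->]] := IHn v; have [u us [m em]] := sP l.
have us' : (index u s < (size s).+1)%N by rewrite ltnW // ltnS index_mem.
pose k := Ordinal us'.
exists (c + (delta_mx 0 k) *+ (p ^ n)), m.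
have -> : l = u + m *+ p by rewrite -em addrC subrK.
rewrite mulrnDl -mulrnA expnS addrA; congr (_ + _).
under [RHS]eq_bigr do rewrite mxE mulrzDr.
rewrite big_split /=; congr (_ + _).
rewrite (bigD1 k) //= big1 => [|i ik]; last first.
  by rewrite !(mxE, mulmxnE) eqxx /= (negbTE ik) mul0rn mulr0z.
by rewrite mulmxnE mxE !eqxx addr0 nth_index //= mulrz_nat.
Qed.

(** Cayley-Hamilton for an integer matrix that describes [act a] modulo [p ^ n] on a spanning
    family. The polynomial changes with [a] and [n], its degree [d] does not. *)
Lemma act_charpoly : exists d, forall a n, exists c : nat -> int, c d = 1 /\
  forall v, exists l, \sum_(k < d.+1) act (a ^+ k)%g v *~ c k = l *+ p ^ n.
Proof.
have [d [e eP]] := finite_span_mod; exists d.+1 => a n.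
pose psi (c : 'rV[int]_d.+1) := \sum_i e i *~ c 0 i.
have [M /choice[r Mr]] := choice (fun i => eP n (act a (e i))).
pose A : 'M[int]_d.+1 := \matrix_(i, j) M i 0 j.
pose Z (x : L) := exists l, x = l *+ p ^ n.
have ZD x y : Z x -> Z y -> Z (x + y) by move=> [l ->] [m ->]; exists (l + m); rewrite mulrnDl.
have psiD c c' : psi (c + c') = psi c + psi c'.
  by rewrite /psi -big_split; apply: eq_bigr => i _; rewrite mxE mulrzDr.
have psiZ z c : psi (z *: c) = psi c *~ z.
  by rewrite /psi mulrz_suml; apply: eq_bigr => i _; rewrite mxE mulrC mulrzA.
have psiA c : exists l, act a (psi c) = psi (c *m A) + l *+ p ^ n.
  exists (\sum_i r i *~ c 0 i); rewrite /psi act_sum.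
  have -> : (\sum_i r i *~ c 0 i) *+ p ^ n = \sum_i (r i *+ p ^ n) *~ c 0 i.
    by rewrite -sumrMnl; apply: eq_bigr => i _; rewrite !pmulrn -!mulrzA mulrC.
  under eq_bigr do rewrite (actMz Aact) Mr mulrzDl.
  rewrite big_split /=; congr (_ + _).
  under eq_bigr do rewrite mulrz_suml.
  rewrite exchange_big /=; apply: eq_bigr => i _.
  rewrite mxE mulrz_sumr; apply: eq_bigr => j _.
  by rewrite mxE -mulrzA mulrC.
have psiAX c k : Z (act (a ^+ k)%g (psi c) - psi (c *m A ^+ k)).
  elim: k c => [|k IHk] c; first by rewrite expg0 (act1 Aact) expr0 mulmx1 subrr; exists 0; rewrite mul0rn.
  rewrite expgSr (actM Aact); have [l ->] := psiA c.
  rewrite (actD Aact) (actMn Aact) addrAC; apply: ZD; last by exists (act (a ^+ k)%g l).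
  by rewrite exprS mulmxA; exact: IHk.
exists (fun k => (char_poly A)`_k); split.
  have /monicP <- := char_poly_monic A.
  by rewrite lead_coefE size_char_poly.
move=> v; have [c [l ->]] := eP n v; rewrite -/(psi c).
suff : Z (\sum_(k < d.+2) act (a ^+ k)%g (psi c) *~ (char_poly A)`_k).
  move=> [m em]; exists (m + \sum_(k < d.+2) act (a ^+ k)%g l *~ (char_poly A)`_k).
  rewrite mulrnDl -em -sumrMnl -big_split /=; apply: eq_bigr => k _.
  by rewrite (actD Aact) (actMn Aact) mulrzDl !pmulrn -!mulrzA [_ * Posz _]mulrC.
have CH : \sum_(k < d.+2) psi (c *m A ^+ k) *~ (char_poly A)`_k = 0.
  have -> : \sum_(k < d.+2) psi (c *m A ^+ k) *~ (char_poly A)`_k = psi (c *m horner_mx A (char_poly A)).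
    have -> : horner_mx A (char_poly A) = \sum_(k < d.+2) (char_poly A)`_k *: A ^+ k.
      rewrite -{1}[char_poly A]coefK poly_def size_char_poly rmorph_sum.
      by apply: eq_bigr => k _; rewrite /= linearZ rmorphXn /= horner_mx_X.
    rewrite mulmx_sumr (big_morph psi psiD (id1 := 0)) => [|//].
      by apply: eq_bigr => k _; rewrite -scalemxAr psiZ.
    by rewrite /psi big1 // => i _; rewrite mxE mulr0z.
  by rewrite Cayley_Hamilton mulmx0 /psi big1 // => i _; rewrite mxE mulr0z.
have -> : \sum_(k < d.+2) act (a ^+ k)%g (psi c) *~ (char_poly A)`_k =
    \sum_(k < d.+2) (act (a ^+ k)%g (psi c) *~ (char_poly A)`_k -
      psi (c *m A ^+ k) *~ (char_poly A)`_k) by rewrite sumrB CH subr0.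
elim/big_ind: _ => [|//|k _]; first by exists 0; rewrite mul0rn.
rewrite -mulrzBl; have [m ->] := psiAX c k.
by exists (m *~ (char_poly A)`_k); rewrite !pmulrn -!mulrzA mulrC.
Qed.
End CharacteristicPolynomial.
End Action.

(** * Commuting operators on a section *)

Section Operators.
Variables (p : nat) (L : zmodType) (U W : set L).
Hypotheses (pU : pure p U) (pW : pure p W) (UW : U `<=` W).

Record operator (f : L -> L) : Prop := Operator {
  opB : forall x y, f (x - y) = f x - f y;
  op_sub : forall x, U x -> U (f x);
  op_sup : forall x, W x -> W (f x) }.

Definition commute_mod (f g : L -> L) := forall w, W w -> U (f (g w) - g (f w)).

Lemma op0 f : operator f -> f 0 = 0.
Proof. by move=> Of; rewrite -{1}(subrr 0) (opB Of) subrr. Qed.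

Lemma opN f x : operator f -> f (- x) = - f x.
Proof. by move=> Of; rewrite -sub0r (opB Of) (op0 Of) sub0r. Qed.

Lemma opD f x y : operator f -> f (x + y) = f x + f y.
Proof. by move=> Of; rewrite -[y in LHS]opprK (opB Of) (opN _ Of) opprK. Qed.

Lemma opMn f x n : operator f -> f (x *+ n) = f x *+ n.
Proof. by move=> Of; elim: n => [|n IHn]; rewrite ?mulr0n ?(op0 Of) // !mulrS (opD _ _ Of) IHn. Qed.

Lemma operator_id : operator id.
Proof. by split. Qed.

Lemma operator_comp f g : operator f -> operator g -> operator (fun x => f (g x)).
Proof.
move=> Of Og; split=> [x y|x Ux|x Wx]; first by rewrite (opB Og) (opB Of).
  by apply/(op_sub Of)/(op_sub Og).
by apply/(op_sup Of)/(op_sup Og).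
Qed.

Lemma operatorB f g : operator f -> operator g -> operator (fun x => f x - g x).
Proof.
move=> Of Og; split=> [x y|x Ux|x Wx].
- by rewrite (opB Of) (opB Og) !opprD addrACA.
- exact: (pureB pU (op_sub Of Ux) (op_sub Og Ux)).
- exact: (pureB pW (op_sup Of Wx) (op_sup Og Wx)).
Qed.

Lemma commute_mod_sym f g : commute_mod f g -> commute_mod g f.
Proof. by move=> cfg w /cfg; exact: (pure_swap pU). Qed.

Lemma commute_mod_comp f g h : operator f -> operator g -> operator h ->
  commute_mod f h -> commute_mod g h -> commute_mod (fun x => f (g x)) h.
Proof.
move=> Of Og Oh cfh cgh w Ww /=; apply: (pure_trans (y := f (h (g w))) pU).
  by rewrite -(opB Of); apply: (op_sub Of); exact: cgh.
by apply: cfh; exact: (op_sup Og).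
Qed.

Lemma commute_modB f g h : operator h ->
  commute_mod f h -> commute_mod g h -> commute_mod (fun x => f x - g x) h.
Proof.
move=> Oh cfh cgh w Ww; rewrite (opB Oh).
have -> : f (h w) - g (h w) - (h (f w) - h (g w)) =
    (f (h w) - h (f w)) - (g (h w) - h (g w)) by rewrite !opprD addrACA.
by apply: (pureB pU); [exact: cfh|exact: cgh].
Qed.

(** On W/U the k-th power of f g is f^k g^k, and f^k is injective. *)
Lemma commute_mod_iter (f g : L -> L) k w : operator f -> operator g ->
  (forall v, W v -> U (f v) -> U v) -> commute_mod f g -> W w ->
  U (iter k (fun v => f (g v)) w) -> U (iter k g w).
Proof.
move=> Of Og finj cfg Ww.
have OXk k' : operator (iter k' f).
  by elim: k' => [|k' IHk]; [exact: operator_id|exact: operator_comp].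
have OGk k' : operator (iter k' g).
  by elim: k' => [|k' IHk]; [exact: operator_id|exact: operator_comp].
have fGk k' : commute_mod (iter k' g) f.
  elim: k' => [|k' IHk] v Wv; first by rewrite /= subrr; exact: pure0 pU.
  by apply: (@commute_mod_comp g (iter k' g) f) => //; exact: commute_mod_sym.
have e k' : U (iter k' (fun v => f (g v)) w - iter k' f (iter k' g w)).
  elim: k' => [|k' IHk] /=; first by rewrite subrr; exact: pure0 pU.
  have Wg : W (iter k' g w) by exact: (op_sup (OGk k')).
  apply: (pure_trans (y := f (g (iter k' f (iter k' g w)))) pU).
    by rewrite -(opB Of) -(opB Og); apply: (op_sub Of); apply: (op_sub Og).
  rewrite -(opB Of); apply: (op_sub Of).
  apply: commute_mod_sym => //.
  move=> v Wv {Wg}; elim: (k') v Wv => [|k'' IH] v Wv; first by rewrite /= subrr; exact: pure0 pU.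
  by apply: (@commute_mod_comp f (iter k'' f) g).
have Uinj k' v : W v -> U (iter k' f v) -> U v.
  elim: k' => //= k' IHk Wv Uf; apply: IHk => //; apply: finj => //.
  by exact: (op_sup (OXk k')).
move=> Ui; apply: (Uinj k); first exact: (op_sup (OGk k)).
have := pureB pU Ui (e k); by rewrite opprB addrC subrK.
Qed.

(** * A Vandermonde argument for commuting operators *)

Section Vandermonde.
Variable X : nat -> L -> L.
Hypotheses (OX : forall i, operator (X i)) (cX : forall i j, commute_mod (X i) (X j)).

Let Y n := [set x | exists u l, [/\ U u, W l & x = u + l *+ p ^ n]].

Let YB n x y : Y n x -> Y n y -> Y n (x - y).
Proof.
move=> [u [l [Uu Wl ->]]] [v [m [Uv Wm ->]]]; exists (u - v), (l - m).
by split; [exact: (pureB pU)|exact: (pureB pW)|rewrite mulrnBl opprD addrACA].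
Qed.

Let Y_mod n x y : U (x - y) -> Y n y -> Y n x.
Proof.
move=> Uxy [u [l [Uu Wl e]]]; exists (x - y + u), l; split=> //; first exact: (pureD pU).
by rewrite -addrA -e subrK.
Qed.

Let Yop f n x : operator f -> Y n x -> Y n (f x).
Proof.
move=> Of [u [l [Uu Wl ->]]]; exists (f u), (f l); split; [exact: (op_sub Of)|exact: (op_sup Of)|].
by rewrite (opD _ _ Of) (opMn _ _ Of).
Qed.

Let delta (q : nat * nat) v := X q.1 v - X q.2 v.
Let prd (t : seq (nat * nat)) v := foldr delta v t.

Let Odelta q : operator (delta q).
Proof. exact: operatorB. Qed.

Let Oprd t : operator (prd t).
Proof. by elim: t => [|q t IHt]; [exact: operator_id|exact: operator_comp]. Qed.

Let cdelta q r : commute_mod (delta q) (delta r).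
Proof.
by apply: commute_modB => //; apply: commute_mod_sym; apply: commute_modB => //; exact: cX.
Qed.

Let cprd t t' : commute_mod (prd t) (prd t').
Proof.
have c0 q t0 : commute_mod (prd t0) (delta q).
  elim: t0 => [|r t0 IHt] w Ww; first by rewrite /= subrr; exact: pure0 pU.
  by apply: (@commute_mod_comp (delta r) (prd t0)).
elim: t => [|r t IHt] w Ww; first by rewrite /= subrr; exact: pure0 pU.
apply: (@commute_mod_comp (delta r) (prd t)) => //.
by apply: commute_mod_sym; exact: c0.
Qed.

Variable ineq : nat -> nat -> Prop.

(* A single product of differences must work for all [n], since it is shown to vanish
   only modulo every [p^n]. *)
Let Sat (v : nat -> L) := exists t, {in t, forall q, ineq q.1 q.2} /\ forall n, Y n (prd t (v n)).

Let SatB v v' : (forall n, W (v n)) -> (forall n, W (v' n)) -> Sat v -> Sat v' -> Sat (fun n => v n - v' n).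
Proof.
move=> Wv Wv' [t [tI tY]] [t' [tI' tY']]; exists (t ++ t'); split=> [q|n].
  by rewrite mem_cat => /orP[/tI|/tI'].
have prd_cat w : prd (t ++ t') w = prd t (prd t' w) by rewrite /prd foldr_cat.
rewrite prd_cat (opB (Oprd _)) (opB (Oprd _)); apply: YB.
  by apply: (Y_mod (cprd t t' (Wv n))); apply: Yop => //; exact: tY.
by apply: Yop => //; exact: tY'.
Qed.

Let Sat_delta q v : ineq q.1 q.2 -> Sat (fun n => delta q (v n)) -> Sat v.
Proof.
move=> qI [t [tI tY]]; exists (rcons t q); split=> [r|n].
  by rewrite mem_rcons inE => /orP[/eqP->|/tI].
by rewrite /prd foldr_rcons; exact: tY.
Qed.

Let Sat_mod v v' : (forall n, U (v n - v' n)) -> Sat v' -> Sat v.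
Proof.
move=> Uv [t [tI tY]]; exists t; split=> // n; apply: Y_mod (tY n).
by rewrite -(opB (Oprd _)); apply: (op_sub (Oprd _)).
Qed.

(** The value at the operator [f] of the polynomial with vector coefficients [us], constant term
    first. *)
Fixpoint horner_op (f : L -> L) (us : seq L) :=
  if us is u :: us' then u + f (horner_op f us') else 0.

(* the quotient of [horner_op X us - horner_op f us] by [X - f] *)
Fixpoint horner_quo (f : L -> L) (us : seq L) :=
  if us is u :: us' then
    if us' is _ :: _ then horner_op f us' :: horner_quo f us' else [::]
  else [::].

Let hornerW f us : operator f -> (forall u, u \in us -> W u) -> W (horner_op f us).
Proof.
move=> Of; elim: us => [|u us IHus] Wus; first exact: pure0 pW.
apply: (pureD pW); first by apply: Wus; rewrite mem_head.
by apply: (op_sup Of); apply: IHus => v vus; apply: Wus; rewrite inE vus orbT.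
Qed.

Let horner_quoW f us : operator f -> (forall u, u \in us -> W u) ->
  forall u, u \in horner_quo f us -> W u.
Proof.
move=> Of; elim: us => [|u us IHus] // Wus v /=.
have Wus' w : w \in us -> W w by move=> wus; apply: Wus; rewrite inE wus orbT.
case: us IHus Wus' {Wus} => // u' us IHus Wus'; rewrite inE => /orP[/eqP->|]; first exact: hornerW.
exact: IHus.
Qed.

Let horner_quo_size f us : size (horner_quo f us) = (size us).-1.
Proof. by elim: us => // u [|u' us] //= ->. Qed.

Let horner_quo_last f us : operator f -> (1 < size us)%N -> last 0 (horner_quo f us) = last 0 us.
Proof.
move=> Of; elim: us => // u [|u' [|u'' us]] IHus // _.
  by rewrite /= (op0 Of) addr0.
Qed.

(** The factor theorem for vector coefficients; it holds modulo [U] because the operators commute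
    only there. *)
Let horner_quoE i j us : (forall u, u \in us -> W u) ->
  U (horner_op (X i) us - horner_op (X j) us - delta (i, j) (horner_op (X i) (horner_quo (X j) us))).
Proof.
elim: us => [|u us IHus] Wus.
  by rewrite /delta /= !(op0 (OX _)) ?addr0 !subrr; exact: pure0 pU.
have Wus' w : w \in us -> W w by move=> wus; apply: Wus; rewrite inE wus orbT.
have {}IHus := IHus Wus'.
case: us IHus Wus' Wus => [|u' us] IHus Wus' Wus.
  by rewrite /delta /= !(op0 (OX _)) ?addr0 !subrr; exact: pure0 pU.
rewrite [horner_op (X i) (u :: _)]/= [horner_op (X j) (u :: _)]/= [horner_quo _ (u :: _)]/=.
move: IHus; set us' := u' :: us; set hi := horner_op (X i) us'; set hj := horner_op (X j) us'.
set q := horner_quo _ us'; move=> IHus /=; rewrite -/hj -/hi.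
have Whi : W hi by exact: hornerW.
set g := horner_op (X i) q in IHus *.
have Wg : W g by apply: hornerW => //; exact: horner_quoW.
have -> : u + X i hi - (u + X j hj) - delta (i, j) (hj + X i g) =
    X i (hi - hj) - delta (i, j) (X i g).
  rewrite (opD _ _ (Odelta _)) (opB (OX i)).
  have -> : delta (i, j) hj = X i hj - X j hj by [].
  move: (delta _ _) (X i hi) (X j hj) (X i hj) => D' A B C.
  rewrite !opprD opprK !addrA.
  by rewrite [LHS](AC 7 (2*5*7*(1*3*(6*4))))/= subrr [B + _]addrC [- B + B]addrC subrr !addr0.
apply: (pure_trans (y := X i (delta (i, j) g)) pU).
  by rewrite -(opB (OX i)); apply: (op_sub (OX i)).
apply: commute_mod_sym => //.
by apply: commute_modB => //; exact: cX.
Qed.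

(** Newton's divided differences: subtracting the value at [X i] and dividing by X - [X i] lowers
    the degree, keeps the leading coefficient, and costs one admissible difference at each remaining
    point. With one point left, the polynomial is its leading coefficient. *)
Lemma vandermonde_sat s (us : nat -> seq L) :
    (0 < size s)%N -> pairwise (fun i j => `[< ineq j i >]) s ->
    (forall n, size (us n) = size s) -> (forall n u, u \in us n -> W u) ->
    {in s, forall i, Sat (fun n => horner_op (X i) (us n))} ->
  Sat (fun n => last 0 (us n)).
Proof.
elim: s us => // i s IHs us _ /= /andP[/allP si ps] sz Wus satus.
have [s0|s0] := posnP (size s).
  have e n : last 0 (us n) = horner_op (X i) (us n).
    have := sz n; rewrite s0; case: (us n) => [|u [|]] //= _.
    by rewrite (op0 (OX i)) addr0.
  by rewrite (_ : (fun n => _) = (fun n => horner_op (X i) (us n)));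
    [apply: satus; rewrite mem_head|apply/funext].
have -> : (fun n => last 0 (us n)) = (fun n => last 0 (horner_quo (X i) (us n))).
  by apply/funext => n; rewrite horner_quo_last // sz ltnS.
apply: IHs => // [n|n|j js].
- by rewrite horner_quo_size sz.
- by apply: horner_quoW => //; exact: Wus.
- apply: (@Sat_delta (j, i)); first exact/asboolP/si.
  apply: (@Sat_mod _ (fun n => horner_op (X j) (us n) - horner_op (X i) (us n))).
    by move=> n; apply: (pure_swap pU); apply: horner_quoE; exact: Wus.
  apply: SatB.
  - by move=> n; exact: (hornerW (OX _) (Wus n)).
  - by move=> n; exact: (hornerW (OX _) (Wus n)).
  - by apply: satus; rewrite inE js orbT.
  - by apply: satus; rewrite inE eqxx.
Qed.

Lemma horner_opE f us : operator f ->
  horner_op f us = \sum_(k < size us) iter k f us`_k.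
Proof.
move=> Of; elim: us => [|u us IHus]; first by rewrite big_ord0.
rewrite /= big_ord_recl /=; congr (_ + _); rewrite IHus.
have fS (I : Type) (r : seq I) (F : I -> L) : f (\sum_(k <- r) F k) = \sum_(k <- r) f (F k).
  exact: (big_morph f (fun x y => opD x y Of) (op0 Of)).
by rewrite fS.
Qed.

(** A monic polynomial of degree [d] is annihilated by d + 1 operators. With its coefficients
    multiplied by [w], the leading one is [w], so a product of injective differences sends [w] into
    every neighbourhood of [U], hence into [U]. *)
Lemma vandermonde_inj s d : size s = d.+1 ->
    pairwise (fun i j => `[< ineq j i >]) s ->
    (forall i j w, ineq i j -> W w -> U (X i w - X j w) -> U w) ->
    (forall n, exists c : nat -> int, c d = 1 /\ {in s, forall i v, exists l,
        \sum_(k < d.+1) iter k (X i) v *~ c k = l *+ p ^ n}) ->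
  W `<=` U.
Proof.
move=> sz ps inj /choice[c cP] w Ww.
pose us n := [seq w *~ c n k | k <- iota 0 d.+1].
have : Sat (fun n => last 0 (us n)).
  apply: (@vandermonde_sat s) => [|//|n|n u|i si].
  - by rewrite sz.
  - by rewrite size_map size_iota sz.
  - by move=> /mapP[k _ ->]; exact: (pureMz _ pW).
  - exists [::]; split=> // n; change (Y n (horner_op (X i) (us n))); have [_ /(_ i si w)[l el]] := cP n.
    exists 0, l; split; first exact: pure0 pU.
      apply: (@pure_divX p _ _ _ n pW); rewrite -el.
      elim/big_ind: _ => [|x y Wx Wy|k _]; [exact: pure0 pW|exact: (pureD pW)|].
      apply: (pureMz _ pW); elim: (nat_of_ord k) => [|m IHm] //=; exact: (op_sup (OX i)).
    rewrite add0r -el horner_opE // size_map size_iota; apply: eq_bigr => k _.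
    rewrite (nth_map 0%N) ?size_iota // nth_iota // add0n.
    move: (c n k) => z; elim: (nat_of_ord k) => [|m IHm] //=; rewrite IHm.
    move: (iter m _ _) => v; case: z {IHm} => z; rewrite ?NegzE ?mulrNz -?pmulrn ?(opN _ (OX i)) (opMn _ _ (OX i)) //.
move=> [t [tI tY]].
have {}tY : U (prd t w).
  apply: (pure_closed pU) => n; have [u [l [Uu _ e]]] := tY n.
  exists u, l; split=> //; rewrite -e /us -(addn1 d) iotaD map_cat last_cat /= add0n.
  by have [-> _] := cP n; rewrite mulr1z.
elim: t tI tY => [|q t IHt] // tI tY; apply: IHt => [r rt|].
  by apply: tI; rewrite inE rt orbT.
apply: (inj q.1 q.2) => //; first by apply: tI; rewrite mem_head.
exact: (op_sup (Oprd _)).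
Qed.

End Vandermonde.
End Operators.

(** A maximal list of pairwise inequivalent indices has at most [d] members; an index is coloured by
    the position of the first member equivalent to it. *)
Lemma equivalence_coloring (R : nat -> nat -> Prop) (d : nat) :
    (forall i j, R i j -> R j i) -> (forall i j k, R i j -> R j k -> R i k) ->
    (forall i, R i i) ->
    (forall s, size s = d.+1 -> ~ pairwise (fun i j => `[< ~ R j i >]) s) ->
  exists chi : nat -> 'I_d.+1, forall i j, chi i = chi j -> R i j.
Proof.
move=> Rsym Rtrans Rrefl Rd.
have [s sd [sR smax]] : exists2 s, (size s <= d)%N &
    pairwise (fun i j => `[< ~ R j i >]) s /\ forall i, exists2 j, j \in s & R j i.
  suff main n s : (d - size s <= n)%N -> (size s <= d)%N -> pairwise (fun i j => `[< ~ R j i >]) s ->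
      exists2 s, (size s <= d)%N &
      pairwise (fun i j => `[< ~ R j i >]) s /\ forall i, exists2 j, j \in s & R j i.
    by apply: (main d [::]); rewrite ?subn0.
  elim: n s => [|n IHn] s dn sd sR;
    have [smax|/existsNP[i nRi]] := EM (forall i, exists2 j, j \in s & R j i); try by exists s.
  have sR' : pairwise (fun i j => `[< ~ R j i >]) (i :: s).
      by rewrite /= sR andbT; apply/allP => j js; apply/asboolP => Rji; apply: nRi; exists j.
    have e : size s = d by apply/eqP; rewrite eqn_leq sd -subn_eq0 -leqn0.
    by case: (Rd (i :: s)); rewrite //= e.
  have sR' : pairwise (fun i j => `[< ~ R j i >]) (i :: s).
    by rewrite /= sR andbT; apply/allP => j js; apply/asboolP => Rji; apply: nRi; exists j.
  have sd' : (size s < d)%N.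
    rewrite ltn_neqAle sd andbT; apply/eqP => e; case: (Rd (i :: s)) => //=; by rewrite e.
  by apply: (IHn (i :: s)); rewrite //= subnS -ltnS prednK ?subn_gt0.
pose a i := find (fun j => `[< R j i >]) s.
have a_lt i : (a i < size s)%N.
  by rewrite -has_find; apply/hasP; have [j js Rji] := smax i; exists j => //; apply/asboolP.
have aR i : R (nth 0%N s (a i)) i.
  have := @nth_find _ 0%N (fun j => `[< R j i >]) s; rewrite has_find => /(_ (a_lt i)).
  by move/asboolP.
exists (fun i => inord (a i)) => i j /(congr1 val); rewrite /= !inordK //.
- by move=> e; apply: (Rtrans _ (nth 0%N s (a i))); [exact: Rsym|rewrite e].
- by rewrite ltnS (leq_trans (ltnW (a_lt j))).
- by rewrite ltnS (leq_trans (ltnW (a_lt i))).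
Qed.

Lemma pigeonhole_nat (T : finType) (chi : nat -> T) : exists i j, (i < j)%N /\ chi i = chi j.
Proof.
have [/injectiveP inj|/injectivePn[i [j nij e]]] :=
    boolP (injectiveb (fun i : 'I_(#|T|.+1) => chi i)).
  by have := leq_card _ inj; rewrite card_ord ltnn.
have [ij|ji|/val_inj ij] := ltngtP i j; last by rewrite ij eqxx in nij.
  by exists i, j.
by exists j, i.
Qed.

(** * Nilpotence and commutation on invariant sections *)

Section Action.
Variables (p : nat) (L : zmodType) (G : groupType) (act : G -> L -> L).
Hypotheses (p_prime : prime p) (Aact : congruence_action p act).
Hypothesis L_fin : exists s : seq L, forall v, exists2 u, u \in s & exists l, v - u = l *+ p.
Variable H : set G.
Hypothesis sH : subgroup H.

Let lat U := pure p U /\ act_invariant act H U.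

Lemma operator_act U W g : (forall x, U x -> U (act g x)) -> (forall x, W x -> W (act g x)) ->
  operator U W (act g).
Proof. by move=> gU gW; split=> // x y; exact: (actB Aact). Qed.

Section InvariantSection.
Variables (U W : set L).
Hypotheses (lU : lat U) (lW : lat W) (UW : U `<=` W).

Let pU : pure p U. Proof. by case: lU. Qed.
Let pW : pure p W. Proof. by case: lW. Qed.

Let OH g : H g -> operator U W (act g).
Proof. by move=> Hg; apply: operator_act; [apply: lU.2|apply: lW.2]. Qed.

Let cm g h := commute_mod U W (act g) (act h).

Let actU g x : H g -> U (act g x) -> U x.
Proof. by move=> Hg Ux; rewrite -(actK Aact g x); apply: lU.2 => //; exact: subgroupV. Qed.

Lemma act_conjg_iter c g k v : iter k (act (c ^ g)%g) v = act g^-1%g (iter k (act c) (act g v)).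
Proof.
elim: k => [|k IHk] /=; first by rewrite (actK Aact).
by rewrite IHk conjgE !(actM Aact) (actVK Aact).
Qed.

(** On W/U, [h ^ a] and [h] have the same [m]-th power, so they agree by uniqueness of roots. *)
Lemma commute_mod_root a h m : H a -> H h -> (0 < m)%N -> cm a (h ^+ m)%g -> cm a h.
Proof.
move=> Ha Hh m0 cam.
have Hha : H (h ^ a)%g by exact: (subgroupM sH (subgroupV sH Ha) (subgroupM sH Hh Ha)).
have root : forall w, W w -> U (act (h ^ a)%g w - act h w).
  apply: (act_root_gt0 p_prime Aact pU pW _ _ _ _ m0);
    try by [apply: lU.2|apply: lW.2].
  move=> w Ww; apply: (actU Ha); rewrite -conjXg (actB Aact) conjgE !(actM Aact) (actVK Aact).
  by apply: (pure_swap pU); exact: cam.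
move=> w /root Uw; have := lU.2 a Ha _ Uw.
by rewrite (actB Aact) conjgE !(actM Aact) (actVK Aact) => /(pure_swap pU).
Qed.

(* On an irreducible section, [x_i - x_j] is either zero or injective, and by the Vandermonde
   argument there are only finitely many classes of equal [x_i]; a composition series thus
   yields a finite colouring of the indices with nilpotent differences inside each colour. *)
Lemma nilpotent_pair c g : H c -> H g ->
    (forall i j, cm (c ^ (g ^+ i))%g (c ^ (g ^+ j))%g) ->
  exists i j k, (i < j)%N /\ forall w, W w ->
    U (iter k (fun v => act (c ^ (g ^+ i))%g v - act (c ^ (g ^+ j))%g v) w).
Proof.
move=> Hc Hg cX; pose x i := (c ^ (g ^+ i))%g.
have Hx i : H (x i).
  have Hgi := subgroupX i sH Hg.
  by exact: (subgroupM sH (subgroupV sH Hgi) (subgroupM sH Hc Hgi)).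
(* The composition series is taken for the operators [x i] alone: they commute, so the kernel of a
   difference is invariant under all of them. *)
pose Inv V := [/\ U `<=` V, V `<=` W & forall i v, V v -> V (act (x i) v)].
pose col U' W' := exists (T : finType) (chi : nat -> T) k, forall i j, chi i = chi j ->
  forall w, W' w -> U' (iter k (fun v => act (x i) v - act (x j) v) w).
have [d dP] := act_charpoly Aact L_fin.
suff [T [chi [k chiP]]] : col U W.
  by have [i [j [ij e]]] := pigeonhole_nat chi; exists i, j, k; split=> //; exact: chiP.
apply: (@pure_lattice_ind p L L_fin Inv col) => //.
- by move=> V _; exists unit, (fun=> tt), 0%N.
(* When two sections are stacked, colours are paired and nilpotency exponents are added. *)
- move=> U1 V W1 _ _ _ _ _ [T1 [chi1 [k1 P1]]] [T2 [chi2 [k2 P2]]].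
  exists (T1 * T2)%type, (fun i => (chi1 i, chi2 i)), (k1 + k2)%N => i j [e1 e2] w Ww.
  by rewrite iterD; apply: P1 => //; exact: P2.
- move=> U1 W1 [pU1 [UU1 U1W xU1]] [pW1 [UW1 W1W xW1]] [U1W1 neq irr].
  pose R i j := forall w, W1 w -> U1 (act (x i) w - act (x j) w).
  have OX i : operator U1 W1 (act (x i)) by exact: (operator_act (xU1 i) (xW1 i)).
  have cX1 i j : commute_mod U1 W1 (act (x i)) (act (x j)).
    by move=> w /W1W Ww; apply: UU1; exact: cX.
  have [|||s sz ps|chi chiP] := @equivalence_coloring R d.
  + by move=> i j Rij w /Rij; exact: (pure_swap pU1).
  + by move=> i j k Rij Rjk w Ww; apply: (pure_trans pU1 (Rij w Ww)); exact: Rjk.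
  + by move=> i w _; rewrite subrr; exact: pure0 pU1.
  + apply: neq; apply/seteqP; split=> //.
    apply: (@vandermonde_inj p L U1 W1 pU1 pW1 (fun i => act (x i)) OX cX1
       (fun i j => ~ R i j) s d sz ps).
      move=> i j w nR Ww Uw.
      pose K := [set w | W1 w /\ U1 (act (x i) w - act (x j) w)].
      have OD : operator U1 W1 (fun v => act (x i) v - act (x j) v) by exact: (operatorB pU1 pW1).
      have UK : U1 `<=` K by move=> v Uv; split; [exact: U1W1|exact: (op_sub OD)].
      have [|//|v []//|KU|KW] := irr K.
      * split; first exact: (pure_kernel (opB OD)).
        split=> [|v [/W1W //]|l v [Wv Uv]]; first exact: subset_trans UK.
        split; first exact: xW1.
        have := @commute_modB p L U1 W1 pU1 _ _ _ (OX l) (cX1 i l) (cX1 j l) v Wv.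
        by move/(pureD pU1)=> /(_ _ (xU1 l _ Uv)); rewrite subrK.
      * by rewrite -KU.
      * by case: nR => v; rewrite -KW => -[].
    (* All the [x i] are conjugate to [c], so they satisfy the same polynomial modulo [p ^ n]. *)
    move=> n; have [f [f1 fP]] := dP c n; exists f; split=> // i _ v.
    have [l el] := fP (act (g ^+ i)%g v); exists (act (g ^+ i)^-1%g l).
    rewrite -(actMn Aact) -el (act_sum Aact); apply: eq_bigr => k _.
    rewrite act_conjg_iter (actMz Aact); congr (act _ _ *~ _).
    elim: (nat_of_ord k) => [|m IHm] /=; first by rewrite expg0 (act1 Aact).
    by rewrite IHm expgS (actM Aact).
  by exists 'I_d.+1, chi, 1%N => i j /chiP.
- by split=> //; split=> // i v Uv; apply: lU.2.
- by split=> //; split=> // i v Wv; apply: lW.2.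
Qed.

Section Irreducible.
Hypothesis irr : irreducible_section p (act_invariant act H) U W.

Section NormalSubset.
Variable A : set G.
Hypotheses (AH : A `<=` H) (AJ : forall a h, A a -> H h -> A (a ^ h)%g).
Hypothesis cA : forall a b, A a -> A b -> cm a b.

Let nilp x y := exists k, forall w, W w -> U (iter k (fun v => act x v - act y v) w).

Let nilpJ x y h : H h -> nilp x y -> nilp (x ^ h)%g (y ^ h)%g.
Proof.
move=> Hh [k nk]; exists k => w Ww.
have -> : iter k (fun v => act (x ^ h)%g v - act (y ^ h)%g v) w =
    act h^-1%g (iter k (fun v => act x v - act y v) (act h w)).
  elim: k {nk} => [|k IHk] /=; first by rewrite (actK Aact).
  rewrite IHk (actB Aact) !conjgE !(actM Aact) !(actVK Aact) //.
by apply: lU.2; [exact: subgroupV|apply: nk; exact: lW.2].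
Qed.

(** The common kernel of all nilpotent differences from [A] is invariant under [H], so it is [U] or
    [W]. It is not [U]: on a section V/U irreducible for [A], the kernel of such a difference is
    invariant since [A] is commutative there, so the difference is zero or injective, and a
    nilpotent one is zero. *)
Lemma nilpotent_trivial x y : A x -> A y -> nilp x y ->
  forall w, W w -> U (act x w - act y w).
Proof.
move=> Ax Ay nxy; have [_ nUW irrUW] := irr.
pose D q := [/\ A q.1, A q.2 & nilp q.1 q.2].
pose K := [set w | W w /\ forall q : G * G, D q -> [set w | W w /\ U (act q.1 w - act q.2 w)] w].
have OD q : D q -> operator U W (fun v => act q.1 v - act q.2 v).
  by move=> [/AH H1 /AH H2 _]; apply: (operatorB pU pW); exact: OH.
have [||v []//|KU|KW] := irrUW K.
- split; first by apply: (pureI pW) => q Dq; apply: (pure_kernel (opB (OD q Dq))).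
  move=> h Hh v [Wv Kv]; split; first exact: lW.2.
  move=> [x' y'] [/= Ax' Ay' nxy']; split; first exact: lW.2.
  have xhE z : act z (act h v) = act h (act (z ^ h)%g v) by rewrite -!(actM Aact) conjgC.
  rewrite !xhE -(actB Aact); apply: lU.2 => //.
  by apply: (Kv ((x' ^ h)%g, (y' ^ h)%g) _).2; split; [exact: AJ|exact: AJ|exact: nilpJ].
- move=> v Uv; split; first exact: UW.
  by move=> q Dq; split; [exact: UW|exact: (op_sub (OD q Dq))].
- have lA V : lat V -> pure p V /\ act_invariant act A V.
    by move=> [pV iV]; split=> // a /AH; apply: iV.
  have [V [[pV iV] VW [UV nUV irrV]]] := pure_irreducible_ex L_fin (lA U lU) (lA W lW) UW nUW.
  case: nUV; apply/seteqP; split=> //.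
  rewrite -[X in _ `<=` X]KU => v Vv; split; first exact: VW.
  move=> q Dq; split; first exact: VW.
  have [Aq1 Aq2 [k nk]] := Dq.
  have UK' : U `<=` [set w | V w /\ U (act q.1 w - act q.2 w)].
    by move=> w Uw; split; [exact: UV|exact: (op_sub (OD q Dq))].
  have [|//|w []//|KU'|KV'] := irrV [set w | V w /\ U (act q.1 w - act q.2 w)].
  + split; first by apply: (pure_kernel (opB (OD q Dq))).
    move=> a Aa w [Vw Uw]; split; first exact: iV.
    have := @commute_modB p L U W pU _ _ _ (OH (AH Aa)) (cA Aq1 Aa) (cA Aq2 Aa) w (VW _ Vw).
    by move/(pureD pU)=> /(_ _ (lU.2 a (AH Aa) _ Uw)); rewrite subrK.
  + apply: (op_sub (OD q Dq)).
    have inj w : V w -> U (act q.1 w - act q.2 w) -> U w by move=> Vw Uw; rewrite -KU'; split.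
    have : U (iter k (fun v => act q.1 v - act q.2 v) v) by apply: nk; exact: VW.
    have Vk m : V (iter m (fun v => act q.1 v - act q.2 v) v).
      by elim: m => //= m IHm; apply: (pureB pV); exact: iV.
    elim: (k) => //= m IHm Um; apply: IHm; exact: inj.
  + by move: Vv; rewrite -{1}KV' => -[].
- by move=> w; rewrite -KW => -[Ww /(_ (x, y))]; case.
Qed.

(** Two of the conjugates of [a] by powers of [h] differ by a nilpotent operator, hence agree. So
    [a] commutes with a positive power of [h], and with [h] by uniqueness of roots. *)
Lemma commuting_normal_central a h : A a -> H h -> cm a h.
Proof.
move=> Aa Hh; have Ha := AH Aa.
have HX i : H (h ^+ i)%g by exact: subgroupX.
have [i [j [k [ij nk]]]] : exists i j k, (i < j)%N /\ forall w, W w ->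
    U (iter k (fun v => act (a ^ (h ^+ i))%g v - act (a ^ (h ^+ j))%g v) w).
  by apply: nilpotent_pair => // i j; apply: cA; exact: AJ.
have e := nilpotent_trivial (AJ Aa (HX i)) (AJ Aa (HX j)) (ex_intro _ k nk).
apply: (@commute_mod_root a h (j - i)%N) => //; first by rewrite subn_gt0.
move=> w Ww; have Wv : W (act (h ^+ i)^-1%g w) by apply: lW.2 => //; exact: subgroupV.
have := lU.2 _ (HX j) _ (e _ Wv).
rewrite (actB Aact) !conjgE !(actM Aact) !(actVK Aact).
have hji : (h ^+ (j - i) = h ^+ j * (h ^+ i)^-1)%g by rewrite expgnFr // ltnW.
by rewrite hji !(actM Aact) => /(pure_swap pU).
Qed.

End NormalSubset.

(** For [b] and [c] in [B], the conjugates of [c] by powers of [b] are products c z_i with z_i in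
    [Z], so they commute on W/U. A nilpotent difference c(z_i - z_j) makes z_i - z_j nilpotent, as
    [c] is invertible, and [nilpotent_trivial] for [Z] makes it zero. So [c] commutes with a power
    of [b], hence with [b], and the preceding lemma applies to [B]. *)
Lemma central_extension_central (B Z : set G) : B `<=` H -> subgroup B ->
    (forall b h, B b -> H h -> B (b ^ h)%g) -> Z `<=` H ->
    (forall z h, Z z -> H h -> Z (z ^ h)%g) ->
    (forall z h, Z z -> H h -> cm z h) ->
    (forall b c, B b -> B c -> Z [~ b, c]%g) ->
  forall b h, B b -> H h -> cm b h.
Proof.
move=> BH sB BJ ZH ZJ cZ BZ; apply: commuting_normal_central => // c b Bc Bb.
have [Hc Hb] := (BH _ Bc, BH _ Bb).
have BX i : B (b ^+ i)%g by exact: subgroupX.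
pose z i := [~ c, b ^+ i]%g; have Zz i : Z (z i) by exact: BZ.
have xE i : (c ^ (b ^+ i) = c * z i)%g by rewrite /z commgEl mulVKg.
have xaE i : act (c ^ (b ^+ i))%g = (fun v => act c (act (z i) v)).
  by apply/funext => v; rewrite xE (actM Aact).
have Oz i : operator U W (act (z i)) by apply/OH/ZH.
have cc g : H g -> cm g g by move=> _ w _; rewrite subrr; exact: pure0 pU.
have czr g i : H g -> cm g (z i) by move=> Hg; apply: (commute_mod_sym pU); exact: cZ.
have [i [j [k [ij nk]]]] : exists i j k, (i < j)%N /\ forall w, W w ->
    U (iter k (fun v => act (c ^ (b ^+ i))%g v - act (c ^ (b ^+ j))%g v) w).
  apply: nilpotent_pair => // i j; rewrite /cm !xaE.
  have OcZ := operator_comp (OH Hc) (Oz j).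
  apply: (commute_mod_comp pU (OH Hc) (Oz i) OcZ).
    apply: (commute_mod_sym pU); apply: (commute_mod_comp pU (OH Hc) (Oz j) (OH Hc)); first exact: cc.
    exact: cZ.
  apply: (commute_mod_sym pU); apply: (commute_mod_comp pU (OH Hc) (Oz j) (Oz i)).
    exact: czr.
  by apply: cZ => //; apply: ZH.
have nz : exists k, forall w, W w -> U (iter k (fun v => act (z i) v - act (z j) v) w).
  exists k => w Ww.
  apply: (commute_mod_iter pU (OH Hc) (operatorB pU pW (Oz i) (Oz j))) => //.
  - by move=> v _; exact: actU.
  - apply: (commute_mod_sym pU); apply: (commute_modB pU (OH Hc)); exact: cZ.
  - have := nk w Ww; rewrite !xaE.
    congr (U (iter k _ w)); apply/funext => v; by rewrite (actB Aact).
have e := nilpotent_trivial ZH ZJ (fun z z' Zz Zz' => cZ z z' Zz (ZH _ Zz')) (Zz i) (Zz j) nz.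
have {}e w : W w -> U (act (c ^ (b ^+ i))%g w - act (c ^ (b ^+ j))%g w).
  by move=> Ww; rewrite !xaE -(actB Aact); apply: lU.2 => //; exact: e.
apply: (@commute_mod_root c b (j - i)%N) => //; first by rewrite subn_gt0.
have HX m : H (b ^+ m)%g by apply: BH.
move=> w Ww; have Wv : W (act (b ^+ i)^-1%g w) by apply: lW.2 => //; exact: subgroupV.
have := lU.2 _ (HX j) _ (e _ Wv).
rewrite (actB Aact) !conjgE !(actM Aact) !(actVK Aact).
have hji : (b ^+ (j - i) = b ^+ j * (b ^+ i)^-1)%g by rewrite expgnFr // ltnW.
by rewrite hji !(actM Aact) => /(pure_swap pU).
Qed.

End Irreducible.
End InvariantSection.
End Action.

End CongruenceModules.

(** * The torsion-free abelian series *)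

Section Series.
Import GRing.Theory.
Local Open Scope classical_set_scope.
Local Open Scope ring_scope.

(** * Virtually solvable groups and quotients by normal subgroups *)

Section GroupLemmas.
Variable G : groupType.
Implicit Types (H K N : set G).
Local Open Scope group_scope.

(** With m cosets, two of the m + 1 powers of [x] from exponent 0 to m share a coset, and the
    difference of their exponents divides m!. *)
Lemma finite_index_exponent H K : subgroup H -> subgroup K -> finite_index H K ->
  exists2 M, (0 < M)%N & forall x, H x -> K (x ^+ M).
Proof.
move=> sH sK; rewrite /finite_index => /finite_setP[m eqm].
have /card_set_bijP[F [Fsub Finj _]] := eqm.
exists m`!; first exact: fact_gt0.
move=> x Hx.
have inC i : cosets H K (mulset [set x ^+ i] K) by exists (x ^+ i) => //; exact: subgroupX.
pose c (i : 'I_m.+1) : 'I_m := Ordinal (Fsub _ (inC i)).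
have [/injectiveP inj|/injectivePn[i [j nij e]]] := boolP (injectiveb c).
  by have := leq_card _ inj; rewrite !card_ord ltnn.
have {e} e : mulset [set x ^+ i] K = mulset [set x ^+ j] K.
  by apply: Finj; rewrite ?inE //; exact: (congr1 val e).
have main (a b : 'I_m.+1) : (a < b)%N -> mulset [set x ^+ a] K = mulset [set x ^+ b] K -> K (x ^+ m`!).
  move=> ab /(mulset1_eq _ _ sK) Kab.
  have Kd : K (x ^+ (b - a)).
    by move: Kab; rewrite -(subnKC (ltnW ab)) expgnDr mulKg addnC addnK.
  have /dvdnP[q ->] : (b - a %| m`!)%N.
    by apply: dvdn_fact; rewrite subn_gt0 ab (leq_trans (leq_subr _ _)) // -ltnS.
  by rewrite mulnC expgnA; exact: subgroupX.
have [ij|ji|/val_inj ij] := ltngtP i j; last by rewrite ij eqxx in nij.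
  exact: main ij e.
exact: main ji (esym e).
Qed.

(** [N k] is the core in [H] of the k-th derived subgroup of [K]. It still contains [x ^+ M] for k =
    0, because conjugates of an [M]-th power are [M]-th powers. *)
Lemma virtually_solvable_series H : subgroup H -> virtually_solvable H ->
  exists (N : nat -> set G) n M, [/\ (0 < M)%N, forall x, H x -> N 0 (x ^+ M),
    forall k, [/\ N k `<=` H, subgroup (N k) & forall x h, N k x -> H h -> N k (x ^ h)],
    forall k x y, N k x -> N k y -> N k.+1 [~ x, y] &
    N n `<=` [set 1]].
Proof.
move=> sH [K [sK KH [n Kn] /(finite_index_exponent sH sK)[M M0 KM]]].
have sD k : subgroup (derived_series K k).
  by elim: k => // k IHk; exact: generated_subgroup.
pose N k := [set x | H x /\ forall h, H h -> derived_series K k (x ^ h)].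
have sHJ x h : H x -> H h -> H (x ^ h).
  by move=> Hx Hh; exact: (subgroupM sH (subgroupV sH Hh) (subgroupM sH Hx Hh)).
exists N, n, M; split=> //.
- move=> x Hx; split=> [|h Hh]; first exact: subgroupX.
  by rewrite conjXg; apply: KM; exact: sHJ.
- move=> k; split=> [x []//||x h [Hx Nx] Hh].
    apply/subgroupP; split=> [|x y [Hx Nx] [Hy Ny]].
      by split=> [|h _]; rewrite ?conj1g; exact: subgroup1.
    split=> [|h Hh]; first exact: subgroupF.
    by rewrite conjMg conjVg; apply: (subgroupF (sD k)); [exact: Nx|exact: Ny].
  split=> [|g Hg]; first exact: sHJ.
  by rewrite -conjgM; apply: Nx; exact: subgroupM.
- move=> k x y [Hx Nx] [Hy Ny]; split=> [|h Hh].
    by rewrite commgEl; apply: (subgroupM sH (subgroupV sH Hx)); exact: sHJ.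
  rewrite conjRg; apply: sub_generated; exists (x ^ h); first exact: Nx.
  by exists (y ^ h) => //; exact: Ny.
- by move=> x [_ /(_ 1 (subgroup1 sH))]; rewrite conjg1 Kn.
Qed.

Lemma mulset_coset N K x y : normal_in N K -> K y ->
  mulset (mulset [set x] N) (mulset [set y] N) = mulset [set x * y] N.
Proof.
move=> /normal_inP[sN sK NK nN] Ky; apply/seteqP; split=> z.
  move=> /mulsetP[u [v [/mulset1P Nu /mulset1P Nv ->]]]; apply/mulset1P.
  have -> : (x * y)^-1 * (u * v) = (x^-1 * u) ^ y * (y^-1 * v).
    by rewrite conjgE !gnorm.
  by apply: (subgroupM sN) => //; exact: nN.
move=> /mulset1P Nz; apply/mulsetP; exists x, (x^-1 * z); split; last by rewrite mulVKg.
  by apply/mulset1P; rewrite mulVg; exact: subgroup1.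
by apply/mulset1P; rewrite mulgA -invgM.
Qed.

Lemma abelian_quotientP N K : normal_in N K ->
  abelian_quotient K N <-> (forall x y, K x -> K y -> N [~ x, y]).
Proof.
move=> nNK; have [sN _ _ _] := (normal_inP _ _).1 nNK.
have RE (x y : G) : [~ x, y] = (y * x)^-1 * (x * y) by rewrite commgEl conjgE !gnorm.
split=> [aNK x y Kx Ky|cN A B].
  have inC z : K z -> mulset [set z] N \in cosets K N by move=> Kz; rewrite inE; exists z.
  have := aNK _ _ (inC y Ky) (inC x Kx).
  by rewrite (mulset_coset _ nNK Ky) (mulset_coset _ nNK Kx) RE => /(mulset1_eq _ _ sN).
rewrite !inE => -[x Kx <-] [y Ky <-].
rewrite (mulset_coset _ nNK Ky) (mulset_coset _ nNK Kx).
by apply/esym/(mulset1_eq _ _ sN); rewrite -RE; exact: cN.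
Qed.

Lemma mulset_one N : mulset [set 1] N = N.
Proof.
apply/seteqP; split=> z; first by move=> /mulset1P; rewrite invg1 mul1g.
by move=> Nz; apply/mulset1P; rewrite invg1 mul1g.
Qed.

Lemma iter_mulset_coset N K x n : normal_in N K -> K x ->
  iter n (mulset (mulset [set x] N)) N = mulset [set x ^+ n] N.
Proof.
move=> nNK Kx; have [_ sK _ _] := (normal_inP _ _).1 nNK.
elim: n => [|n IHn] /=; first by rewrite mulset_one.
by rewrite IHn (mulset_coset _ nNK) ?expgS //; exact: subgroupX.
Qed.

Lemma coset_eq1 N x : subgroup N -> mulset [set x] N = N <-> N x.
Proof.
move=> sN; rewrite -[X in _ = X](mulset_one N); split=> [/esym|Nx].
  by move=> /(mulset1_eq _ _ sN); rewrite invg1 mul1g.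
by apply/esym/(mulset1_eq _ _ sN); rewrite invg1 mul1g.
Qed.

Lemma torsion_free_quotientP N K : normal_in N K ->
  torsion_free_quotient K N <->
  (forall x n, K x -> (0 < n)%N -> N (x ^+ n) -> N x).
Proof.
move=> nNK; have [sN _ _ _] := (normal_inP _ _).1 nNK; split=> [tNK x n Kx n0 Nxn|tN A].
  apply/(coset_eq1 x sN); apply: (tNK _ _ n n0); first by rewrite inE; exists x.
  by rewrite (iter_mulset_coset _ nNK Kx); apply/coset_eq1.
rewrite inE => -[x Kx <-] n n0; rewrite (iter_mulset_coset _ nNK Kx).
by move=> /(coset_eq1 _ sN)/(tN _ _ Kx n0)/(coset_eq1 _ sN).
Qed.

End GroupLemmas.

Section PureTorsion.
Variables (p : nat) (L : zmodType).

(** The power of [p] in [m] is removed by purity; the remaining factor is invertible modulo every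
    [p ^ n], which puts [x] in U + p^n L, and [U] is closed. *)
Lemma pure_torsion U x m : prime p -> pure p (U : set L) -> (0 < m)%N -> U (x *+ m) -> U x.
Proof.
move=> p_pr pU m0; have [a pa em] := pfactor_coprime p_pr m0.
rewrite em mulrnA => /(pure_divX pU) Ua.
apply: (pure_closed pU) => n.
have a0 : (0 < a)%N by move: m0; rewrite em muln_gt0 => /andP[].
have [u v e _] := egcdnP (p ^ n) a0.
have g1 : gcdn a (p ^ n) = 1%N by apply/eqP; rewrite gcdnC -/(coprime _ _) coprimeXl.
exists (x *+ a *+ u), (- x *+ v); split; first exact: (pureMn _ pU).
by rewrite -!mulrnA mulNrn [(a * u)%N]mulnC e g1 mulrnDr mulr1n addrAC subrr add0r.
Qed.

Hypothesis L_sep : forall v : L, (forall n, exists l, v = l *+ p ^ n) -> v = 0.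
Hypothesis L_tf : forall v : L, v *+ p = 0 -> v = 0.

Lemma pure_set0 : pure p [set (0 : L)].
Proof.
split=> //= [x y -> ->|x Ux]; first by rewrite subrr.
by apply: L_sep => n; have [u [l [-> ->]]] := Ux n; exists l; rewrite add0r.
Qed.

End PureTorsion.

(** * The invariant flag and the series of H *)

Section CongruenceSeries.
Variables (p : nat) (L : zmodType) (G : groupType) (act : G -> L -> L).
Hypotheses (p_prime : prime p) (Aact : congruence_action p act).
Hypothesis L_fin : exists s : seq L, forall v, exists2 u, u \in s & exists l, v - u = l *+ p.
Variable H : set G.
Hypotheses (sH : subgroup H) (vsH : virtually_solvable H).

Let lat U := pure p U /\ act_invariant act H U.

(** Climbing from the trivial [N n] to [N 0], each [N k] acts centrally because its commutators lie
    in the central [N k.+1]. Since [y ^+ M] lies in [N 0], it commutes with [x], and roots are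
    unique. *)
Lemma irreducible_commute U W : lat U -> lat W ->
    irreducible_section p (act_invariant act H) U W ->
  forall x y, H x -> H y -> commute_mod U W (act x) (act y).
Proof.
move=> lU lW irr; have [UW _ _] := irr; have pU := lU.1.
have [N [n [M [M0 HM HN NR Nn]]]] := virtually_solvable_series sH vsH.
have N0 : forall x h, N 0%N x -> H h -> commute_mod U W (act x) (act h).
  suff main k : (k <= n)%N -> forall x h, N (n - k)%N x -> H h -> commute_mod U W (act x) (act h).
    by have := main n (leqnn n); rewrite subnn.
  elim: k => [_ x h|k IHk kn].
    rewrite subn0 => /Nn -> _ w _; rewrite !(act1 Aact) subrr; exact: pure0 pU.
  have e : (n - k = (n - k.+1).+1)%N by rewrite subnS prednK // subn_gt0.
  have [NH sN NJ] := HN (n - k.+1)%N; have [ZH sZ ZJ] := HN (n - k)%N.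
  apply: (central_extension_central p_prime Aact L_fin sH lU lW UW irr NH sN NJ ZH ZJ).
    by apply: IHk; exact: ltnW.
  by move=> b c Nb Nc; rewrite e; exact: NR.
move=> x y Hx Hy; apply: (commute_mod_root p_prime Aact sH lU lW Hx Hy M0).
by apply: (commute_mod_sym pU); apply: N0 => //; exact: HM.
Qed.

Hypothesis L_sep : forall v : L, (forall n, exists l, v = l *+ p ^ n) -> v = 0.
Hypothesis L_tf : forall v : L, v *+ p = 0 -> v = 0.

Let chain U W n F := [/\ F 0%N = U, F n = W, forall i, (i <= n)%N -> lat (F i),
   forall i, (i < n)%N -> F i `<=` F i.+1 &
   forall i, (i < n)%N -> forall x y, H x -> H y -> commute_mod (F i) (F i.+1) (act x) (act y)].

Lemma congruence_flag : exists n F, chain [set 0] [set: L] n F.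
Proof.
pose R U W := exists n F, chain U W n F.
have l0 : lat [set 0].
  by split; [exact: pure_set0|move=> g _ x /= ->; exact: act0 Aact g].
apply: (@pure_lattice_ind p L L_fin (act_invariant act H) R) => //.
- by move=> U lU; exists 0%N, (fun=> U); split.
- move=> U V W lU lV lW UV VW [n [F [F0 Fn lF FS FC]]] [m [E [E0 Em lE ES EC]]].
  exists (n + m)%N, (fun i => if (i <= n)%N then F i else E (i - n)%N).
  have gE i : (n <= i)%N -> (if (i <= n)%N then F i else E (i - n)%N) = E (i - n)%N.
    move=> ni; case: ifP => // in'; have -> : i = n by apply/eqP; rewrite eqn_leq in'.
    by rewrite subnn Fn E0.
  split=> [//||i im|i im|i im x y Hx Hy].
  + by rewrite /= gE ?leq_addr // addnC addnK.
  + by case: leqP => ni; [exact: lF|apply: lE; rewrite leq_subLR].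
  + have [ni|ni] := ltnP i n; first by rewrite /= (ltnW ni); exact: FS.
    by rewrite /= gE // subSn //; apply: ES; rewrite ltn_subLR.
  + have [ni|ni] := ltnP i n; first by rewrite /= (ltnW ni); exact: FC.
    by rewrite /= gE // subSn //; apply: EC => //; rewrite ltn_subLR.
- move=> U W lU lW irr; exists 1%N, (fun i => if i == 0%N then U else W).
  split=> // [[|i]//|[|i]//= _|[|i]//= _ x y Hx Hy].
    by case: irr.
  exact: irreducible_commute.
Qed.

Hypothesis act_faithful : forall h, (forall v, act h v = v) -> forall g, commute h g.
Hypothesis G_tf : forall (g : G) m, (0 < m)%N -> (g ^+ m = 1 -> g = 1)%g.

Lemma congruence_series : exists n (Hs : nat -> set G),
  [/\ Hs 0%N = [set 1%g], Hs n = H, forall i, (i <= n)%N -> normal_in (Hs i) H &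
    forall i, (i < n)%N -> [/\ normal_in (Hs i) (Hs i.+1),
      abelian_quotient (Hs i.+1) (Hs i) & torsion_free_quotient (Hs i.+1) (Hs i)]].
Proof.
have [n [F [F0 Fn lF FS FC]]] := congruence_flag.
have pF i : (i <= n)%N -> pure p (F i) by move=> /lF[].
have HF i g v : (i <= n)%N -> H g -> F i v -> F i (act g v) by move=> /lF[_ iF] Hg; exact: iF.
have Fle i j : (i <= j)%N -> (j <= n)%N -> F i `<=` F j.
  move=> /subnK <-; elim: (j - i)%N => [|k IHk]; first by rewrite add0n => _ v.
  rewrite addSn => kn.
  by move=> v Fv; apply: (FS _ kn); apply: IHk => //; exact: ltnW.
(* The subtraction is truncated and [F 0] is zero, so for [j] at most [k] the condition says that
   [h] fixes [F j]. *)
pose D k := [set h | H h /\ forall j, (j <= n)%N -> forall v, F j v -> F (j - k)%N (act h v - v)].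
have DH k : D k `<=` H by move=> h [].
have Djn j k : (j <= n)%N -> (j - k <= n)%N by move=> jn; rewrite (leq_trans (leq_subr _ _)).
have sD k : subgroup (D k).
  apply/subgroupP; split=> [|x y [Hx Dx] [Hy Dy]].
    split=> [|j jn v _]; first exact: subgroup1.
    by rewrite (act1 Aact) subrr; exact: pure0 (pF _ (Djn _ _ jn)).
  split=> [|j jn v Fv]; first exact: subgroupF.
  have Fyv : F j (act y^-1%g v) by apply: HF => //; exact: subgroupV.
  rewrite (actM Aact) -{2}(actVK Aact y v); move: (act y^-1%g v) Fyv => w Fw.
  apply: (pure_trans (y := w) (pF _ (Djn _ _ jn))); first exact: Dx.
  by apply: (pure_swap (pF _ (Djn _ _ jn))); exact: Dy.
have nD k : normal_in (D k) H.
  apply/normal_inP; split=> // x h [Hx Dx] Hh.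
  split=> [|j jn v Fv]; first exact: (subgroupM sH (subgroupV sH Hh) (subgroupM sH Hx Hh)).
  rewrite conjgE !(actM Aact) -{2}(actK Aact h v) -(actB Aact).
  by apply: (HF); [exact: Djn|exact: subgroupV|apply: Dx => //; exact: HF].
have DS k : D k.+1 `<=` D k.
  move=> h [Hh Dh]; split=> // j jn v Fv; have := Dh j jn v Fv.
  by apply: Fle; [rewrite leq_sub2l|exact: Djn].
have DR k x y : D k x -> D k y -> D k.+1 [~ x, y]%g.
  move=> Dx Dy; have [[Hx Px] [Hy Py]] := (Dx, Dy).
  have -> : [~ x, y]%g = ((y * x)^-1 * (x * y))%g by rewrite commgEl conjgE !gnorm.
  have Hyx := subgroupV sH (subgroupM sH Hy Hx).
  split=> [|j jn v Fv]; first by apply: (subgroupM sH) => //; exact: subgroupM.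
  rewrite (actM Aact) -{2}(actK Aact (y * x)%g v) -(actB Aact).
  apply: HF => //; first exact: Djn.
  rewrite !(actM Aact); case: k Dx Dy Px Py => [|k] Dx Dy Px Py.
    case: j jn v Fv => [|j] jn v Fv.
      by move: Fv; rewrite F0 => /= ->; rewrite !(act0 Aact) subrr ?sub0n ?F0.
    by rewrite subSS subn0; exact: FC.
  (* xy - yx = (x - 1)(y - 1) - (y - 1)(x - 1), and two successive factors lower the flag by at
     least [k.+2] steps. For [k] = 0, treated before, it is the commutativity on the factors of the
     flag that is used. *)
  have -> : act x (act y v) - act y (act x v) =
      (act x (act y v - v) - (act y v - v)) - (act y (act x v - v) - (act x v - v)).
    rewrite !(actB Aact); move: (act x (act y v)) (act y (act x v)) (act x v) (act y v) => a b c d.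
    rewrite !opprD !opprK !addrA.
    by rewrite [RHS](AC 8 (1*5*((2*7)*(3*6)*(4*8))))/= !addNr subrr !addr0.
  have Fk z w : F (j - k.+1)%N w -> D k.+1 z -> F (j - k.+2)%N (act z w - w).
    move=> Fw [Hz Pz]; have := Pz _ (Djn j k.+1 jn) w Fw.
    by apply: Fle; [rewrite -subnDA leq_sub2l // addSn ltnS addnS ltnS leq_addr|exact: Djn].
  by apply: (pureB (pF _ (Djn j k.+2 jn))); apply: Fk => //; [exact: Py|exact: Px].
have Dtf k x m : D k x -> (0 < m)%N -> D k.+1 (x ^+ m)%g -> D k.+1 x.
  move=> [Hx Px] m0 [_ Pxm]; split=> // j jn v Fv.
  case: k Px Pxm => [|k] Px Pxm.
    case: j jn v Fv => [|j] jn v Fv.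
      by move: Fv; rewrite F0 => /= ->; rewrite !(act0 Aact) subrr ?sub0n ?F0.
    rewrite subSS subn0; have jn' := ltnW jn.
    have := act_root_gt0 p_prime Aact (pF j jn') (pF j.+1 jn) (a := x) (b := 1%g) (n := m).
    (* At the top level [x] and 1 have the same [m]-th power on each factor, hence agree there. *)
    move=> root; rewrite -[X in _ - X](act1 Aact); apply: root Fv => //.
    + by move=> w; exact: HF.
    + by move=> w; rewrite (act1 Aact).
    + by move=> w; exact: HF.
    + by move=> w; rewrite (act1 Aact).
    + by move=> w Fw; rewrite expg1n (act1 Aact); have := Pxm _ jn w Fw; rewrite subSS subn0.
  have pj := pF _ (Djn j k.+2 jn).
  apply: (pure_torsion p_prime pj m0).
  set d := act x v - v; have Fd : F (j - k.+1)%N d by exact: Px.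
  have Fxd : F (j - k.+2)%N (act x d - d).
    have := Px _ (Djn j k.+1 jn) d Fd.
    by apply: Fle; [rewrite -subnDA leq_sub2l // addSn ltnS addnS ltnS leq_addr|exact: Djn].
  have dE : act x v = v + d by rewrite /d addrC subrK.
  have em := Pxm j jn v Fv; clearbody d.
  (* Below the top, x^i - 1 is i(x - 1) up to one further step of the flag; so [m] times the image
     of x - 1 is in the target, and purity removes [m]. *)
  have e i : F (j - k.+2)%N (act (x ^+ i)%g v - v - d *+ i).
    elim: i => [|i IHi].
      by rewrite expg0 (act1 Aact) subrr mulr0n subr0; exact: pure0 pj.
    rewrite expgS (actM Aact).
    have -> : act x (act (x ^+ i)%g v) - v - d *+ i.+1 =
        act x (act (x ^+ i)%g v - v - d *+ i) + (act x d - d) *+ i.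
      rewrite !(actB Aact) (actMn Aact) dE mulrS mulrnBl !opprD.
      move: (act x (act _ v)) (act x d *+ i) (d *+ i) => a c f; rewrite !addrA.
      by rewrite [RHS](AC 6 (1*2*3*6*(4*5)))/= addNr addr0.
    by apply: (pureD pj); [apply: (HF) => //; exact: Djn|exact: (pureMn _ pj)].
  have := pureB pj em (e m).
  by rewrite opprB addrC subrK.
have DnP h : D n h -> forall v, act h v = v.
  move=> [_ Ph] v; have := Ph n (leqnn n) v; rewrite Fn subnn F0 => /(_ I) /= e.
  by apply/eqP; rewrite -subr_eq0 e.
have D0 : D 0%N = H.
  apply/seteqP; split=> // h Hh; split=> // j jn v Fv.
  by rewrite subn0; apply: (pureB (pF j jn)) => //; exact: HF.
have n1 : normal_in [set (1%g : G)] H.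
  apply/normal_inP; split=> //; first exact: subgroup_set1.
    by move=> _ ->; exact: subgroup1.
  by move=> x h -> _ /=; rewrite conj1g.
have normal_sub (N K : set G) : normal_in N H -> normal_in K H -> N `<=` K -> normal_in N K.
  move=> /normal_inP[sN _ _ nN] /normal_inP[sK _ KH _] NK; apply/normal_inP; split=> //.
  by move=> x y Nx /KH; exact: nN.
(* The order of the [D k] is reversed, and the trivial group is put below [D n], which acts
   trivially on [L] and is therefore central, but may be nontrivial. *)
exists n.+1, (fun i => if i is i'.+1 then D (n - i')%N else [set 1%g]).
split=> //; first by rewrite subnn.
  by case=> [|i] _.
case=> [|i] ilt.
  have nD1 : normal_in [set 1%g] (D (n - 0)%N).
    by apply: normal_sub => // _ ->; exact: subgroup1.
  split=> //.
    apply/(abelian_quotientP nD1) => x y; rewrite subn0 => /DnP/act_faithful cx _.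
    by apply/eqP/commgP.
  by apply/(torsion_free_quotientP nD1) => x m _ m0 /=; exact: G_tf.
have e : (n - i = (n - i.+1).+1)%N by rewrite subnS prednK // subn_gt0.
have nDD : normal_in (D (n - i)%N) (D (n - i.+1)%N) by apply: normal_sub => //; rewrite e.
split=> //.
  by apply/(abelian_quotientP nDD) => x y Dx Dy; rewrite e; exact: DR.
by apply/(torsion_free_quotientP nDD) => x m Dx m0; rewrite e; exact: Dtf.
Qed.

End CongruenceSeries.

End Series.

(** * Unique products *)

Section UniqueProducts.
Local Open Scope classical_set_scope.
Local Open Scope group_scope.

Section PositiveCones.
Variable G : groupType.

(** The preimage in [K] of a positive cone of K/N, without its identity. *)
Record relative_cone (N K S : set G) : Prop := RelativeCone {
  cone_sub : S `<=` K;
  coneM : forall x y, S x -> S y -> S (x * y);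
  cone_mull : forall n x, N n -> S x -> S (n * x);
  cone_mulr : forall x n, S x -> N n -> S (x * n);
  cone_disjoint : forall x, S x -> ~ N x }.

(** Zorn's lemma gives a maximal [S]. If neither [x] nor its inverse can be adjoined, [S] contains a
    negative power of each, and suitable powers of these two multiply to 1, which is in [N]. *)
Lemma relative_cone_total (N K : set G) : normal_in N K ->
    (forall x y, K x -> K y -> N [~ x, y]) ->
    (forall x n, K x -> (0 < n)%N -> N (x ^+ n) -> N x) ->
  exists2 S, relative_cone N K S & forall x, K x -> [\/ N x, S x | S x^-1].
Proof.
move=> /normal_inP[sN sK NK nN] KR Ktf.
have [|S [SP Smax]] := @Zorn_bigcup G (relative_cone N K).
  move=> F FP Ftot; split.
  - by move=> x [S FS Sx]; exact: (cone_sub (FP S FS)).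
  - move=> x y [S FS Sx] [S' FS' Sy]; have [SS'|S'S] := Ftot S S' FS FS'.
      by exists S' => //; apply: (coneM (FP _ FS')) => //; exact: SS'.
    by exists S => //; apply: (coneM (FP _ FS)) => //; exact: S'S.
  - by move=> n x Nn [S FS Sx]; exists S => //; exact: (cone_mull (FP _ FS)).
  - by move=> x n [S FS Sx] Nn; exists S => //; exact: (cone_mulr (FP _ FS)).
  - by move=> x [S FS Sx]; exact: (cone_disjoint (FP _ FS)).
exists S => // x Kx; apply: contrapT => nx.
have nNx : ~ N x by move=> Nx; apply: nx; constructor 1.
pose T c := S c \/ N c.
have TK c : T c -> K c by move=> [/(cone_sub SP)|/NK].
have TM a b : T a -> T b -> T (a * b).
  move=> [Sa|Na] [Sb|Nb]; [left; exact: (coneM SP)|left; exact: (cone_mulr SP)| |].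
    by left; exact: (cone_mull SP).
  by right; exact: subgroupM.
have SX a k : S a -> S (a ^+ k.+1).
  by move=> Sa; elim: k => // k IHk; rewrite expgS; exact: (coneM SP).
(* otherwise [S] is enlarged by the elements [c u^k] with [c] in [S] or [N] *)
have extend u : K u -> ~ N u -> ~ S u -> exists k, S (u ^- k.+1).
  move=> Ku nNu nSu; apply: contrapT => nS.
  have KX k : K (u ^+ k) by exact: subgroupX.
  pose S1 := [set z | exists c k, [/\ T c, z = c * u ^+ k & (0 < k)%N \/ S c]].
  apply: (Smax S1).
    split; last first.
      move=> S1S; apply: nSu; apply: S1S; exists 1, 1%N.
      by split; [right; exact: subgroup1|rewrite mul1g|left].
    by move=> c Sc; exists c, 0%N; split; [left|rewrite mulg1|right].
  split.
  - by move=> _ [c [k [/TK Kc -> _]]]; exact: subgroupM.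
  - move=> _ _ [c [k [Tc -> ck]]] [d [l [Td -> dl]]].
    have e : c * u ^+ k * (d * u ^+ l) = c * (d * [~ d, u ^- k]) * u ^+ (k + l).
      by rewrite commgEl conjgE expgnDr !gnorm.
    have Tn : T [~ d, u ^- k] by right; apply: KR; [exact: TK|exact: (subgroupV sK)].
    exists (c * (d * [~ d, u ^- k])), (k + l)%N; split=> //.
      by apply: (TM _ _ Tc); exact: TM.
    case: k {e Tn} ck (KX k) => [|k] ck _; last by left.
    case: l dl => [|l] dl; last by left.
    right; case: ck => // Sc; case: dl => // Sd.
    apply: (coneM SP) => //; apply: (cone_mulr SP) => //.
    by apply: KR; [exact: (cone_sub SP)|apply: (subgroupV sK); exact: subgroup1].
  - move=> n _ Nn [c [k [Tc -> ck]]]; exists (n * c), k; rewrite mulgA; split=> //.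
      by apply: TM => //; right.
    by case: ck => [|Sc]; [left|right; exact: (cone_mull SP)].
  - move=> _ n [c [k [Tc -> ck]]] Nn.
    have Nn' : N (n ^ (u ^- k)) by apply: nN => //; exact: (subgroupV sK).
    exists (c * n ^ (u ^- k)), k; split.
    + by apply: TM => //; right.
    + by rewrite conjgE !gnorm.
    + by case: ck => [|Sc]; [left|right; exact: (cone_mulr SP)].
  - move=> _ [c [k [Tc -> ck]]] Nck.
    case: k ck Nck => [|k] ck Nck.
      by case: ck => // Sc; apply: (cone_disjoint SP Sc); rewrite mulg1 in Nck.
    have e : u ^- k.+1 = (c * u ^+ k.+1)^-1 * c by rewrite !gnorm.
    have [Se|Ne] : T (u ^- k.+1) by rewrite e; apply: TM => //; right; exact: (subgroupV sN).
      by apply: nS; exists k.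
    by apply: nNu; apply: (Ktf _ k.+1) => //; rewrite -[_ ^+ _]invgK; exact: (subgroupV sN).
have nNxV : ~ N x^-1 by move=> /(subgroupV sN); rewrite invgK.
have [k Sk] : exists k, S (x ^- k.+1).
  by apply: extend => // Sx; apply: nx; constructor 2.
have [l] : exists l, S (x^-1 ^- l.+1).
  by apply: extend => //; [exact: (subgroupV sK)|move=> Sx; apply: nx; constructor 3].
rewrite expVgn invgK => Sl.
have := coneM SP (SX _ k Sl) (SX _ l Sk).
rewrite -expVgn -!expgnA mulnC expVgn mulgV => /(cone_disjoint SP); apply; exact: subgroup1.
Qed.

Record positive_cone (H P : set G) : Prop := PositiveCone {
  posM : forall x y, P x -> P y -> P (x * y);
  pos_total : forall x, H x -> [\/ x = 1, P x | P x^-1];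
  pos_not1 : ~ P 1 }.

(* The left-invariant order [x < y := P (x^-1 y)] has maxima on finite sets;
   with [y] the maximum of [Y], the maximum of [X y] is uniquely represented in [X Y] *)
Lemma positive_cone_unique_product (H P : set G) :
  subgroup H -> positive_cone H P -> unique_product H.
Proof.
move=> sH PP X Y /finite_seqP[s ->] /finite_seqP[t ->] XH YH [x1 Xx1] [y1 Yy1].
have maxP (r : seq G) : (forall z, z \in r -> H z) -> r != [::] ->
    exists2 m, m \in r & forall z, z \in r -> z = m \/ P (z^-1 * m).
  elim: r => // z r IHr rH _; have [r0|r0] := eqVneq r [::].
    by exists z; rewrite ?mem_head // r0 => z'; rewrite inE => /eqP; left.
  have rH' z' : z' \in r -> H z' by move=> rz; apply: rH; rewrite inE rz orbT.
  have [m rm mmax] := IHr rH' r0; have Hz := rH z (mem_head _ _); have Hm := rH' m rm.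
  have [/mulg1_eq|Pzm|Pmz] := pos_total PP (subgroupM sH (subgroupV sH Hz) Hm).
  - rewrite invgK => zm; exists m; first by rewrite inE rm orbT.
    by move=> z'; rewrite inE => /orP[/eqP->|/mmax //]; left.
  - exists m; first by rewrite inE rm orbT.
    by move=> z'; rewrite inE => /orP[/eqP->|/mmax //]; right.
  - rewrite invgM invgK in Pmz; exists z; first exact: mem_head.
    move=> z'; rewrite inE => /orP[/eqP->|/mmax[->|Pz]]; [by left|by right|right].
    by rewrite -[z'^-1](mulgK m) -mulgA; exact: posM PP _ _ Pz Pmz.
have nil_notin (r : seq G) z : z \in r -> r != [::] by case: r.
have [y0 ty0 y0max] := maxP t YH (nil_notin _ _ Yy1).
have Hy0 := YH _ ty0.
have [||g /mapP[x0 sx0 ->] gmax] := maxP [seq x * y0 | x <- s].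
- by move=> _ /mapP[x sx ->]; apply: (subgroupM sH) => //; exact: XH.
- by move: Xx1 => /=; case: (s).
exists (x0 * y0); first by apply: (subgroupM sH) => //; exact: XH.
exists (x0, y0); split=> //= -[x y] [/= sx ty e].
have [yy0|Py] := y0max y ty.
  by rewrite yy0 in e *; rewrite (mulIg _ _ _ e).
(* Otherwise [x * y0] would exceed [x0 * y0] by the positive element [y^-1 * y0]. *)
have Pxy : P ((x0 * y0)^-1 * (x * y0)) by rewrite e !gnorm.
have [exx|Pxx] := gmax (x * y0) (map_f (fun x => x * y0) sx).
  by case: (pos_not1 PP); move: Pxy; rewrite exx mulVg.
case: (pos_not1 PP); have := posM PP Pxy Pxx.
by rewrite -mulgA (mulgA (x * y0)) mulgV mul1g mulVg.
Qed.

(** Orders are combined lexicographically along the series: the cone of [Hs i] is joined with the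
    preimage of a cone of the next factor. Conjugation invariance is not asked of the cone, so the
    order obtained is a left order. *)
Lemma series_unique_product (H : set G) n (Hs : nat -> set G) : subgroup H ->
    Hs 0 = [set 1] -> Hs n = H ->
    (forall i, (i < n)%N -> [/\ normal_in (Hs i) (Hs i.+1),
      abelian_quotient (Hs i.+1) (Hs i) & torsion_free_quotient (Hs i.+1) (Hs i)]) ->
  unique_product H.
Proof.
move=> sH Hs0 Hsn series.
suff [P PP] : exists P, positive_cone H P by exact: positive_cone_unique_product PP.
rewrite -Hsn.
suff main i : (i <= n)%N -> exists2 P, P `<=` Hs i & positive_cone (Hs i) P.
  by have [P _ PP] := main n (leqnn n); exists P.
elim: i => [_|i IHi ilt].
  by exists set0 => //; rewrite Hs0; split=> // x /= ->; constructor 1.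
have [P PN PP] := IHi (ltnW ilt).
have [nNK aNK tNK] := series i ilt.
have [sN sK NK nN] := (normal_inP _ _).1 nNK.
have [S SP Stot] := relative_cone_total nNK ((abelian_quotientP nNK).1 aNK)
  ((torsion_free_quotientP nNK).1 tNK).
exists (P `|` S); first by move=> x [/PN/NK|/(cone_sub SP)].
split=> [x y [Px|Sx] [Py|Sy]|x Kx|[|/(cone_disjoint SP)]].
- by left; exact: (posM PP).
- by right; apply: (cone_mull SP) => //; exact: PN.
- by right; apply: (cone_mulr SP) => //; exact: PN.
- by right; exact: (coneM SP).
- have [/(pos_total PP)[->|Px|Px]|Sx|Sx] := Stot x Kx.
  + by constructor 1.
  + by constructor 2; left.
  + by constructor 3; left.
  + by constructor 2; right.
  + by constructor 3; right.
- exact: (pos_not1 PP).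
- by apply; exact: subgroup1.
Qed.

End PositiveCones.

End UniqueProducts.

(** * The action by conjugation and the conclusion *)

Import GRing.Theory.

Theorem mainTheorem5 (p : nat) (G : topologicalGroupType) (H : set G)
    (p_prime : prime p) (G_uniform : uniform_pro_p p G)
    (H_subgroup : subgroup H) (H_vsolvable : virtually_solvable H) :
  unique_product H /\
  exists (n : nat) (Hs : nat -> set G),
    [/\ Hs 0 = [set (1%g : G)]%classic, Hs n = H,
        (forall i, (i <= n)%N -> normal_in (Hs i) H) &
        (forall i, (i < n)%N ->
           [/\ normal_in (Hs i) (Hs i.+1),
               abelian_quotient (Hs i.+1) (Hs i) &
               torsion_free_quotient (Hs i.+1) (Hs i)])].
Proof.
suff [n [Hs [Hs0 Hsn nHs qHs]]] : exists (n : nat) (Hs : nat -> set G),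
    [/\ Hs 0 = [set (1%g : G)]%classic, Hs n = H,
        (forall i, (i <= n)%N -> normal_in (Hs i) H) &
        (forall i, (i < n)%N ->
           [/\ normal_in (Hs i) (Hs i.+1),
               abelian_quotient (Hs i.+1) (Hs i) &
               torsion_free_quotient (Hs i.+1) (Hs i)])].
  split; first exact: series_unique_product H_subgroup Hs0 Hsn qHs.
  by exists n, Hs; split.
have [L [e [[e' eK e'K] eX eP eJ]]] := uniform_additive_group p_prime G_uniform.
have e1 : e 1%g = 0%R by rewrite -(expg0 1%g) eX mulr0n.
have e_inj := can_inj eK.
(* Conjugation [x ^ h] is a right action; the inverse turns it into a left one. *)
pose act (h : G) (v : L) := e (e' v ^ h^-1)%g.
have actB h v w : act h (v - w)%R = (act h v - act h w)%R.
  apply/eqP; rewrite eq_sym subr_eq; apply/eqP; rewrite /act.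
  by apply: eJ; rewrite !e'K subrK.
have Aact : congruence_action p act.
  split=> // [v|g h v|g v].
  - by rewrite /act invg1 conjg1.
  - by rewrite /act eK invgM conjgM.
  (* The displacement of [v] under [g] is the class of a commutator. It lies in [P 2] for every [p],
     and in [P 3] for [p] = 2 by powerfulness, which gives the moduli [p] and 4. *)
  - have PE n : lower_p_series p G n.+1 [~ e' v, g^-1]%g ->
        exists l, (act g v - v = l *+ p ^ n)%R.
      by rewrite commgEl => /eP; rewrite e'K.
    case: eqP => [p2|_]; last first.
      by have := PE 1%N; rewrite expn1; apply; exact: lower_p_seriesR.
    have := PE 2%N; rewrite {2}p2; apply.
    by apply: lower_2_seriesR => //; case: G_uniform.
have L_fin : exists s : seq L, forall v, exists2 u, u \in s & exists l, (v - u = l *+ p)%R.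
  have [s sP] := uniform_cosets p_prime G_uniform.
  exists (map e s) => v; have [u us Pu] := sP (e' v); exists (e u); first exact: map_f.
  by have /eP := Pu; rewrite e'K expn1.
have L_sep (v : L) : (forall n, exists l, v = (l *+ p ^ n)%R) -> v = 0%R.
  move=> vp; rewrite -(e'K v) -e1; congr e.
  apply: (lower_p_series_separation p_prime); first by case: G_uniform.
  by move=> i; rewrite -[e' v]mul1g -[X in (X * _)%g]invg1; apply/eP; rewrite e'K e1 subr0.
have L_tf (v : L) : (v *+ p = 0)%R -> v = 0%R.
  rewrite -{1}(e'K v) -eX -e1 => /e_inj/(uniform_torsion p_prime G_uniform) e'v.
  by rewrite -(e'K v) e'v.
apply: (congruence_series p_prime Aact L_fin H_subgroup H_vsolvable L_sep L_tf).
  (* As [e] is bijective, acting trivially on [L] means centralising [G]. *)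
  move=> h acth g; apply/commute_sym/commgP; rewrite -conjg_fix; apply/eqP.
  have := acth (e (g ^ h)%g); rewrite /act eK => /e_inj.
  by rewrite conjgK => <-.
move=> g m m0 gm; apply: e_inj; rewrite e1.
(* The zero subgroup is pure, so [L] is torsion-free, and [e] turns powers into multiples. *)
have := @pure_torsion p L [set 0%R]%classic (e g) m p_prime (pure_set0 L_sep L_tf) m0.
by apply; rewrite -eX gm e1.
Qed.
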